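(* Let $(V,\Upsilon(z),c,\rho)$ be a graded vertex operator coalgebra, $g\in\mathrm{Aut}\,V$ an automorphism of finite order $T$, and $\pi:V\to V^g$ the canonical projection onto the fixed points quotient graded vertex operator coalgebra. Then $\pi$ induces a linear map $\pi:C_g(V)\to C(V^g)$. Furthermore, for any $v\in C_g(V)$, $$(\pi\otimes\pi)\circ\Delta_g(v)=\Delta\circ\pi(v),\qquad c(v)=c_{V^g}\circ\pi(v).$$ In other words, if $(C_g(V),\Delta_g,c)$ is a coassociative coalgebra, then $\pi$ induces a homomorphism of coassociative coalgebras, and $C_g(V)$ is a subcoalgebra of $C(V^g)$.
   Context: All vector spaces are over $\mathbb C$; $\tau(v\otimes w)=w\otimes v$; $(z_1+z_2)^n$ is expanded in nonnegative powers of $z_2$; $\delta(x)=\sum_{n\in\mathbb Z}x^n$; $\mathrm{Res}_z$ is the coefficient of $z^{-1}$. Graded vertex operator coalgebra $(V,\Upsilon(z),c,\rho)$: $V=\bigoplus_{s\in\mathbb Z}V_s$, $\dim V_s<\infty$, $V_s=0$ for $s\ll0$; linear maps $c,\rho:V\to\mathbb C$ and $\Upsilon(z):V\to(V\otimes V)[[z,z^{-1}]]$, $\Upsilon(z)v=\sum_{k\in\mathbb Z}\Delta_k(v)z^{-k-1}$, with: (1) $\Delta_k(v)=0$ for $k\ll0$ and $\Delta_k(V_s)\subseteq(V\otimes V)_{s+k+1}$; (2) $(c\otimes\mathrm{Id})\Upsilon(z)v=v$, $(\mathrm{Id}\otimes c)\Upsilon(z)v\in V[[z]]$ with constant term $v$;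 (3) Jacobi identity $z_0^{-1}\delta(\frac{z_1-z_2}{z_0})(\mathrm{Id}\otimes\Upsilon(z_2))\Upsilon(z_1)-z_0^{-1}\delta(\frac{z_2-z_1}{-z_0})(\tau\otimes\mathrm{Id})(\mathrm{Id}\otimes\Upsilon(z_1))\Upsilon(z_2)=z_1^{-1}\delta(\frac{z_2+z_0}{z_1})(\Upsilon(z_0)\otimes\mathrm{Id})\Upsilon(z_2)$; (4) writing $(\rho\otimes\mathrm{Id})\Upsilon(z)=\sum_kL(k)z^{k-2}$, the operators $L(k)\in\mathrm{End}(V)$ satisfy $[L(k),L(j)]=(k-j)L(k+j)+\frac{k^3-k}{12}\delta_{k+j,0}d$ for a constant $d$, $V_s$ is the $s$-eigenspace of $L(0)$, and $(L(1)\otimes\mathrm{Id})\Upsilon(z)=\frac{d}{dz}\Upsilon(z)$. Automorphisms: linear bijections $g$ of $V$ with $c\circ g=c$, $\rho\circ g=\rho$, $\Upsilon(z)g=(g\otimes g)\Upsilon(z)$. For $g$ of order $T$: $V^{(r)}=\{v: gv=e^{2\pi ir/T}v\}$, $0\le r\le T-1$; $\frac{\ln g}{2\pi i}$ acts on $V^{(r)}$ as $\frac rT$; $\delta_0:V\to V$ is the projection onto $V^{(0)}$ along $\bigoplus_{r\ne0}V^{(r)}$. $V^g=V/\bigoplus_{r=1}^{T-1}V^{(r)}$ with the graded vertex operator coalgebra structure determined by $\Upsilon_{V^g}(z)\circ\pi=(\pi\otimes\pi)\circ\Upsilon(z)$, $c_{V^g}\circ\pi=c$, $\rho_{V^g}\circ\pi=\rho$.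 $C_g(V)=\{v\in V:\ \mathrm{Res}_z\big(\tfrac{(1+z)^{L(0)-1+\delta_0+\frac{\ln g}{2\pi i}}}{z^{1+\delta_0}}\otimes\mathrm{Id}\big)\Upsilon(z)v=0\}$, where the operator on the first tensor factor acts on $V_s\cap V^{(r)}$ as $(1+z)^{s}z^{-2}$ if $r=0$ and $(1+z)^{s-1+r/T}z^{-1}$ if $r\ne0$. For $v\in C_g(V)$, $\Delta_g(v)=\mathrm{Res}_z\big(\tfrac{\delta_0\circ(1+z)^{L(0)}}{z}\otimes\mathrm{Id}\big)\Upsilon(z)v$. Residues are a priori elements of $\prod_n(V\otimes V)_n$. $C(V^g)=\{v\in V^g:\ \mathrm{Res}_z\big(\tfrac{(1+z)^{L(0)}}{z^2}\otimes\mathrm{Id}\big)\Upsilon_{V^g}(z)v=0\}$, with coproduct $\Delta(v)=\mathrm{Res}_z\big(\tfrac{(1+z)^{L(0)}}{z}\otimes\mathrm{Id}\big)\Upsilon_{V^g}(z)v$ and counit $c_{V^g}|_{C(V^g)}$; it is the (untwisted) coassociative coalgebra associated with $V^g$. That $C_g(V)$ is a subcoalgebra means it is identified via $\pi$ (which is injective on $C_g(V)$) with one. *)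

(* Defs.v *)
From HB Require Import structures.
From mathcomp Require Import all_boot all_order all_algebra ring_quotient.
From mathcomp Require Import complex.
From mathcomp Require Import all_classical all_reals.
From mathcomp Require Import trigo.
Set Implicit Arguments.
Unset Strict Implicit.
Unset Printing Implicit Defensive.
Import Order.TTheory GRing.Theory Num.Theory.
Local Open Scope classical_set_scope.
Local Open Scope ring_scope.
Local Open Scope quotient_scope.

(** * Sums with finite support

    [\sum_(i \in [set: I]) f i] is the sum over the support of [f] when that
    support is finite, and [0] otherwise; all the sums below have finite support. *)

Section FiniteSupport.
Context {I : choiceType} {V : zmodType}.

Definition finsupp (f : I -> V) : Prop :=
  exists s : seq I, forall i, i \notin s -> f i = 0.

Lemma fsum_seq (f : I -> V) (s : seq I) :
  (forall i, i \notin s -> f i = 0) ->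
  \sum_(i \in [set: I]) f i = \sum_(i <- undup s) f i.
Proof.
move=> fs; rewrite (fsbigE (undup s)) ?undup_uniq//.
- by rewrite big_mkcond; apply: eq_bigr => i _; rewrite in_setT.
- by move=> i _; rewrite mem_undup; apply: fs.
Qed.

Lemma finsupp2 (f g : I -> V) : finsupp f -> finsupp g ->
  exists s : seq I, (forall i, i \notin s -> f i = 0) /\ (forall i, i \notin s -> g i = 0).
Proof.
move=> [s fs] [t gt]; exists (s ++ t); split=> i; rewrite mem_cat negb_or => /andP[h1 h2].
  exact: fs.
exact: gt.
Qed.

Lemma finsuppD (f g : I -> V) : finsupp f -> finsupp g -> finsupp (fun i => f i + g i).
Proof.
move=> hf hg; have [s [hs ht]] := finsupp2 hf hg.
by exists s => i hi; rewrite hs// ht// addr0.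
Qed.

Lemma fsumD (f g : I -> V) : finsupp f -> finsupp g ->
  \sum_(i \in [set: I]) (f i + g i) =
  \sum_(i \in [set: I]) f i + \sum_(i \in [set: I]) g i.
Proof.
move=> hf hg; have [s [hs ht]] := finsupp2 hf hg.
rewrite (fsum_seq hs) (fsum_seq ht) (fsum_seq (s := s)) ?big_split//.
by move=> i hi; rewrite hs// ht// addr0.
Qed.

Lemma fsum_only (f : I -> V) (i : I) : (forall j, j != i -> f j = 0) ->
  \sum_(j \in [set: I]) f j = f i.
Proof.
move=> h; rewrite (fsum_seq (s := [:: i])) ?big_seq1// => j.
by rewrite inE; apply: h.
Qed.

End FiniteSupport.

Lemma fsum_morph {I : choiceType} {V W : zmodType} (f : I -> V) (F : V -> W) :
  F 0 = 0 -> {morph F : x y / x + y} -> finsupp f ->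
  F (\sum_(i \in [set: I]) f i) = \sum_(i \in [set: I]) F (f i).
Proof.
move=> F0 FD [s fs]; rewrite (fsum_seq fs) (fsum_seq (s := s)); last first.
  by move=> i hi; rewrite fs.
exact: (big_morph F FD F0).
Qed.

Lemma finsupp_morph {I : choiceType} {V W : zmodType} (f : I -> V) (F : I -> V -> W) :
  (forall i, F i 0 = 0) -> finsupp f -> finsupp (fun i => F i (f i)).
Proof. by move=> F0 [s fs]; exists s => i hi; rewrite fs. Qed.

Lemma fsum_linear {I : choiceType} {K : fieldType} {V W : lmodType K} (f : I -> V)
  (F : {linear V -> W}) : finsupp f ->
  F (\sum_(i \in [set: I]) f i) = \sum_(i \in [set: I]) F (f i).
Proof. by move=> h; apply: fsum_morph h; [exact: linear0|exact: linearD]. Qed.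

Lemma subspace_fsum {I : choiceType} {K : fieldType} {V : lmodType K} (S : set V) (f : I -> V) :
  S 0 -> (forall (a : K) (u v : V), S u -> S v -> S (a *: u + v)) ->
  (forall i, S (f i)) -> S (\sum_(i \in [set: I]) f i).
Proof.
move=> S0 SD Sf; elim/big_rec: _ => // i x _ Sx.
by rewrite -[f i]scale1r; apply: SD.
Qed.

Lemma fsum_lin {I : choiceType} {K : fieldType} {V : lmodType K} (a : K) (f g : I -> V) :
  finsupp f -> finsupp g ->
  \sum_(i \in [set: I]) (a *: f i + g i) =
  a *: \sum_(i \in [set: I]) f i + \sum_(i \in [set: I]) g i.
Proof.
move=> hf hg; rewrite fsumD//.
  by rewrite (fsum_morph (F := fun x => a *: x))// ?scaler0// => x y; rewrite scalerDr.
by apply: (finsupp_morph (F := fun=> *:%R a)) => // _; rewrite scaler0.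
Qed.

Definition is_subspace {K : fieldType} {V : lmodType K} (S : set V) : Prop :=
  S 0 /\ forall (a : K) (u v : V), S u -> S v -> S (a *: u + v).

Record subspace (K : fieldType) (V : lmodType K) := Subspace {
  subspace_set :> V -> Prop;
  subspaceP : is_subspace subspace_set }.
Arguments Subspace {K V}.

Section Subspace.
Context {K : fieldType} {V : lmodType K}.
Implicit Type S : subspace V.

Definition subspace_pred S : {pred V} := fun v => `[< S v >].

Fact subspace_pred_closed S : submod_closed (subspace_pred S).
Proof.
have [S0 SD] := subspaceP S; split; first exact/asboolP.
by move=> a u v /asboolP hu /asboolP hv; apply/asboolP/SD.
Qed.
HB.instance Definition _ S :=
  GRing.isSubmodClosed.Build K V (subspace_pred S) (subspace_pred_closed S).

Record subspace_elt S := SubspaceElt {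
  subspace_val : V; _ : subspace_val \in subspace_pred S }.
HB.instance Definition _ S := [isSub for @subspace_val S].
HB.instance Definition _ S := [Choice of subspace_elt S by <:].
HB.instance Definition _ S := [SubChoice_isSubLmodule of subspace_elt S by <:].

Definition sublmod S : lmodType K := subspace_elt S.

Definition subincl S : {linear sublmod S -> V} := (\val : subspace_elt S -> V).

Lemma subinclP S (x : sublmod S) : S (subincl S x).
Proof. by have := valP x => /asboolP. Qed.

Lemma subincl_inj S : injective (subincl S). Proof. exact: val_inj. Qed.

Definition subelt S (v : V) (h : S v) : sublmod S := SubspaceElt (introT (asboolP _) h).

Definition quot_space S := Quotient.quot (subspace_pred S).
HB.instance Definition _ S := GRing.Zmodule.on (quot_space S).

Section Quot.
Variable S : subspace V.
Local Notation Q := (quot_space S).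
Let pr (v : V) : Q := \pi_(Quotient.quot (subspace_pred S)) v.

Let prP (u v : V) : S (u - v) <-> pr u = pr v.
Proof.
split=> [h|/eqP].
  by apply/eqP; rewrite -Quotient.idealrBE; apply/asboolP.
by rewrite -Quotient.idealrBE => /asboolP.
Qed.

Let prD u v : pr (u + v) = pr u + pr v. Proof. by rewrite /pr !piE. Qed.

Let S_scale a u : S u -> S (a *: u).
Proof. by move=> hu; rewrite -[_ *: _]addr0; apply: (subspaceP S).2 => //; exact: (subspaceP S).1. Qed.

Definition quot_scale (a : K) (x : Q) : Q := pr (a *: repr x).

Let quot_scaleE a u : quot_scale a (pr u) = pr (a *: u).
Proof.
apply/prP; rewrite -scalerBr; apply: S_scale; apply/prP.
by rewrite /pr reprK.
Qed.

Let prK (x : Q) : pr (repr x) = x. Proof. by rewrite /pr reprK. Qed.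

Fact quot_scaleA a b x : quot_scale a (quot_scale b x) = quot_scale (a * b) x.
Proof. by rewrite -[x]prK !quot_scaleE scalerA. Qed.
Fact quot_scale1 : left_id 1 quot_scale.
Proof. by move=> x; rewrite -[x]prK quot_scaleE scale1r. Qed.
Fact quot_scaleDr : right_distributive quot_scale +%R.
Proof.
by move=> a x y; rewrite -[x]prK -[y]prK -prD !quot_scaleE -prD scalerDr.
Qed.
Fact quot_scaleDl x : {morph quot_scale^~ x : a b / a + b}.
Proof. by move=> a b; rewrite -[x]prK !quot_scaleE -prD scalerDl. Qed.

HB.instance Definition _ := GRing.Zmodule_isLmodule.Build K Q
  quot_scaleA quot_scale1 quot_scaleDr quot_scaleDl.

Definition quot_proj (v : V) : Q := pr v.

Fact quot_proj_linear : linear quot_proj.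
Proof. by move=> a u v; rewrite /quot_proj prD -quot_scaleE. Qed.
HB.instance Definition _ := GRing.isLinear.Build K V Q *:%R quot_proj quot_proj_linear.

Lemma quot_projP (v : V) : quot_proj v = 0 <-> S v.
Proof.
by rewrite -[X in S X]subr0 prP -/(quot_proj v) -/(quot_proj 0) linear0.
Qed.

Lemma quot_proj_repr (x : Q) : quot_proj (repr x) = x. Proof. exact: prK. Qed.

Lemma quot_ind (P : Q -> Prop) : (forall v, P (quot_proj v)) -> forall x, P x.
Proof. by move=> h x; rewrite -[x]quot_proj_repr. Qed.

(* The map induced by a linear map vanishing on [S]. *)
Definition quot_lift {W : Type} (F : V -> W) (x : Q) : W := F (repr x).

Lemma quot_liftE {W : lmodType K} (F : {linear V -> W}) (v : V) :
  (forall u, S u -> F u = 0) -> quot_lift F (quot_proj v) = F v.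
Proof.
move=> hF; apply/eqP; rewrite -subr_eq0 -linearB hF//.
by apply/prP; exact: prK.
Qed.

Lemma quot_lift_linear {W : lmodType K} (F : {linear V -> W}) :
  (forall u, S u -> F u = 0) -> linear (quot_lift F).
Proof.
move=> hF a; apply: quot_ind => u; apply: quot_ind => v.
by rewrite -linearP !quot_liftE// linearP.
Qed.

End Quot.
End Subspace.

(** * Tensor products

    [tensor V W] is the commutative monoid of formal finite sums of pairs
    modulo the relations of the tensor product; the scalars act on the first factor. *)

Section Tensor.
Context {K : fieldType} (V W : lmodType K).

Inductive tensor_rel : seq (V * W) -> seq (V * W) -> Prop :=
| tensor_refl s : tensor_rel s s
| tensor_sym s t : tensor_rel s t -> tensor_rel t s
| tensor_trans s t u : tensor_rel s t -> tensor_rel t u -> tensor_rel s u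
| tensor_cat s s' t t' : tensor_rel s s' -> tensor_rel t t' -> tensor_rel (s ++ t) (s' ++ t')
| tensor_comm s t : tensor_rel (s ++ t) (t ++ s)
| tensor_zero w : tensor_rel [:: (0, w)] [::]
| tensor_addl v v' w : tensor_rel [:: (v + v', w)] [:: (v, w); (v', w)]
| tensor_addr v w w' : tensor_rel [:: (v, w + w')] [:: (v, w); (v, w')]
| tensor_scal a v w : tensor_rel [:: (a *: v, w)] [:: (v, a *: w)].

Let trel : rel (seq (V * W)) := fun s t => `[< tensor_rel s t >].

Fact tensor_equiv : equiv_class_of trel.
Proof.
split=> [s|s t|t s u].
- exact/asboolP/tensor_refl.
- by apply/asboolP/asboolP; exact: tensor_sym.
- by move=> /asboolP h /asboolP h'; apply/asboolP; exact: tensor_trans h h'.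
Qed.
Canonical tensor_equiv_rel := EquivRelPack tensor_equiv.
Canonical tensor_enc := defaultEncModRel trel.

Definition tensor_quot := {eq_quot trel}.
HB.instance Definition _ : EqQuotient (seq (V * W)) trel tensor_quot :=
  EqQuotient.on tensor_quot.
HB.instance Definition _ := Choice.on tensor_quot.

Let pr (s : seq (V * W)) : tensor_quot := \pi_tensor_quot s.

Let prP s t : tensor_rel s t <-> pr s = pr t.
Proof.
split=> [h|/eqmodP /asboolP//].
by apply/eqmodP/asboolP.
Qed.

Let prK x : pr (repr x) = x. Proof. by rewrite /pr reprK. Qed.
Let reprP s : tensor_rel (repr (pr s)) s. Proof. exact/prP/prK. Qed.

Let scal (a : K) (s : seq (V * W)) := [seq (a *: p.1, p.2) | p <- s].

Let scal_rel a s t : tensor_rel s t -> tensor_rel (scal a s) (scal a t).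
Proof.
elim=> {s t}.
- by move=> s; exact: tensor_refl.
- by move=> s t _; exact: tensor_sym.
- by move=> s t u _ h _; exact: tensor_trans.
- by move=> s s' t t' _ h _ h'; rewrite /scal !map_cat; exact: tensor_cat.
- by move=> s t; rewrite /scal !map_cat; exact: tensor_comm.
- by move=> w /=; rewrite scaler0; exact: tensor_zero.
- by move=> v v' w /=; rewrite scalerDr; exact: tensor_addl.
- by move=> v w w' /=; exact: tensor_addr.
- by move=> b v w /=; rewrite scalerA mulrC -scalerA; exact: tensor_scal.
Qed.

Definition tensor_add (x y : tensor_quot) : tensor_quot :=
  \pi_tensor_quot (repr x ++ repr y).
Local Notation add := tensor_add.
Definition tensor_scale (a : K) (x : tensor_quot) : tensor_quot :=
  \pi_tensor_quot [seq (a *: p.1, p.2) | p <- repr x].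
Local Notation scl := tensor_scale.
Let addE s t : add (pr s) (pr t) = pr (s ++ t).
Proof. by apply/prP; apply: tensor_cat; exact: reprP. Qed.
Let sclE a s : scl a (pr s) = pr (scal a s).
Proof. by apply/prP; apply: scal_rel; exact: reprP. Qed.

Fact tensor_addA : associative add.
Proof. by move=> x y z; rewrite -[x]prK -[y]prK -[z]prK !addE catA. Qed.
Fact tensor_addC : commutative add.
Proof. by move=> x y; rewrite -[x]prK -[y]prK !addE; exact/prP/tensor_comm. Qed.
Fact tensor_add0 : left_id (\pi_tensor_quot [::]) add.
Proof. by move=> x; rewrite -[x]prK addE. Qed.
Fact tensor_scaleDl x a b : scl (a + b) x = add (scl a x) (scl b x).
Proof.
have ACA x1 y1 z1 t1 : add (add x1 y1) (add z1 t1) = add (add x1 z1) (add y1 t1).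
  rewrite -!tensor_addA; congr (add _ _).
  by rewrite !tensor_addA [add y1 z1]tensor_addC.
have consE p s : pr (p :: s) = add (pr [:: p]) (pr s) by rewrite addE.
rewrite -[x]prK !sclE; elim: (repr x) => [|[v w] s IH]; first by rewrite addE.
rewrite /scal/= -!/(scal _ _) consE IH [in RHS]consE [X in _ = add _ X]consE ACA.
by congr (add _ _); rewrite addE; apply/prP; rewrite scalerDl; exact: tensor_addl.
Qed.
Let scl0 x : scl 0 x = pr [::].
Proof.
rewrite -[x]prK sclE; elim: (repr x) => [//|[v w] s IH].
rewrite -[LHS]/(pr ([:: _] ++ scal 0 s)) -addE IH scale0r.
by have /prP -> := tensor_zero w; rewrite addE.
Qed.
Fact tensor_scale1 : left_id 1 scl.
Proof.
move=> x; rewrite -[x]prK sclE /scal; congr pr; elim: (repr x) => //= -[v w] s ->.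
by rewrite scale1r.
Qed.
Fact tensor_addN : left_inverse (\pi_tensor_quot [::]) (scl (-1)) add.
Proof. by move=> x; rewrite -{2}[x]tensor_scale1 -tensor_scaleDl addNr scl0. Qed.

HB.instance Definition _ := GRing.isZmodule.Build tensor_quot tensor_addA tensor_addC tensor_add0 tensor_addN.

Fact tensor_scaleA a b x : scl a (scl b x) = scl (a * b) x.
Proof.
rewrite -[x]prK !sclE /scal -map_comp; congr pr; apply: eq_map => -[v w] /=.
by rewrite scalerA.
Qed.
Fact tensor_scaleDr : right_distributive scl +%R.
Proof.
move=> a x y; rewrite -[x + y]/(add x y) -[_ + _]/(add _ _) -[x]prK -[y]prK.
by rewrite !(addE, sclE) /scal map_cat.
Qed.
HB.instance Definition _ := GRing.Zmodule_isLmodule.Build K tensor_quot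
  tensor_scaleA tensor_scale1 tensor_scaleDr tensor_scaleDl.

Definition tensor : lmodType K := tensor_quot.

Definition tens (v : V) (w : W) : tensor := pr [:: (v, w)].

Lemma tensDl w : {morph tens^~ w : u v / u + v}.
Proof.
by move=> u v; rewrite /tens -[RHS]/(add _ _) addE; exact/prP/tensor_addl.
Qed.
Lemma tensDr v : {morph tens v : u w / u + w}.
Proof.
by move=> u w; rewrite /tens -[RHS]/(add _ _) addE; exact/prP/tensor_addr.
Qed.
Lemma tensZl a v w : tens (a *: v) w = a *: tens v w.
Proof. by rewrite /tens -[RHS]/(scl _ _) sclE. Qed.
Lemma tensZr a v w : tens v (a *: w) = a *: tens v w.
Proof. by rewrite -tensZl; apply/esym/prP; exact: tensor_scal. Qed.

Let pr_sum s : pr s = \sum_(p <- s) tens p.1 p.2.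
Proof.
elim: s => [|[v w] s IH]; first by rewrite big_nil.
by rewrite big_cons -IH -[RHS]/(add _ _) addE.
Qed.

Lemma tensor_repr (x : tensor) : x = \sum_(p <- repr (x : tensor_quot)) tens p.1 p.2.
Proof. by rewrite -pr_sum prK. Qed.

Lemma tensor_ind (P : tensor -> Prop) : P 0 -> (forall x y, P x -> P y -> P (x + y)) ->
  (forall v w, P (tens v w)) -> forall x, P x.
Proof.
move=> P0 PD Pt x; rewrite [x]tensor_repr.
by elim/big_rec: _ => // -[v w] y _ Py; apply: PD.
Qed.

Section Lift.
Context {U : lmodType K}.

Definition bilinear_map (b : V -> W -> U) : Prop :=
  (forall w a u v, b (a *: u + v) w = a *: b u w + b v w) /\
  (forall v a u w, b v (a *: u + w) = a *: b v u + b v w).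

(* The linear map induced by [b]; only meaningful when [b] is bilinear. *)
Definition tensor_lift (b : V -> W -> U) (x : tensor) : U :=
  \sum_(p <- repr (x : tensor_quot)) b p.1 p.2.

Variable b : V -> W -> U.
Hypothesis hb : bilinear_map b.

Let b0l w : b 0 w = 0.
Proof.
by have := hb.1 w 1 0 0; rewrite !scale1r addr0 -[LHS]addr0 => /addrI.
Qed.
Let b0r v : b v 0 = 0.
Proof.
by have := hb.2 v 1 0 0; rewrite !scale1r addr0 -[LHS]addr0 => /addrI.
Qed.
Let bDl u v w : b (u + v) w = b u w + b v w.
Proof. by have := hb.1 w 1 u v; rewrite !scale1r. Qed.
Let bDr u v w : b w (u + v) = b w u + b w v.
Proof. by have := hb.2 w 1 u v; rewrite !scale1r. Qed.
Let bZl a v w : b (a *: v) w = a *: b v w.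
Proof. by have := hb.1 w a v 0; rewrite b0l !addr0. Qed.
Let bZr a v w : b v (a *: w) = a *: b v w.
Proof. by have := hb.2 v a w 0; rewrite b0r !addr0. Qed.

Let ev (s : seq (V * W)) := \sum_(p <- s) b p.1 p.2.
Let ev_rel s t : tensor_rel s t -> ev s = ev t.
Proof.
elim=> {s t}//; rewrite /ev.
- by move=> s t u _ -> _ ->.
- by move=> s s' t t' _ h _ h'; rewrite !big_cat/= h h'.
- by move=> s t; rewrite !big_cat/= addrC.
- by move=> w; rewrite big_cons !big_nil b0l addr0.
- by move=> v v' w; rewrite !big_cons !big_nil !addr0 bDl.
- by move=> v v' w; rewrite !big_cons !big_nil !addr0 bDr.
- by move=> a v w; rewrite !big_cons !big_nil bZl bZr.
Qed.
Let lift_pr s : tensor_lift b (pr s) = ev s.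
Proof. exact/ev_rel/reprP. Qed.

Lemma tensor_liftE v w : tensor_lift b (tens v w) = b v w.
Proof. by rewrite -[tens v w]/(pr [:: (v, w)]) lift_pr /ev big_cons big_nil addr0. Qed.

Lemma tensor_lift_linear : linear (tensor_lift b).
Proof.
move=> a x y; rewrite -[a *: x + y]/(add (scl a x) y) -[x]prK -[y]prK sclE addE.
rewrite !lift_pr /ev big_cat /scal big_map/= scaler_sumr.
by congr (_ + _); apply: eq_bigr => p _; rewrite bZl.
Qed.

End Lift.
End Tensor.

Arguments tens {K V W}.
Arguments tensor_lift {K V W U}.

Lemma eq_tensor {K : fieldType} {V W U : lmodType K} (f g : {linear tensor V W -> U}) :
  (forall v w, f (tens v w) = g (tens v w)) -> f =1 g.
Proof.
move=> h; apply: tensor_ind => //; first by rewrite !linear0.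
by move=> x y hx hy; rewrite !linearD hx hy.
Qed.

Section TensorMaps.
Context {K : fieldType}.
Implicit Types U V W : lmodType K.

Lemma tens0l V W (w : W) : tens (0 : V) w = 0.
Proof. by rewrite -(scale0r 0) tensZl scale0r. Qed.
Lemma tens0r V W (v : V) : tens v (0 : W) = 0.
Proof. by rewrite -(scale0r 0) tensZr scale0r. Qed.

Lemma tens_bilinear V W : bilinear_map (@tens K V W).
Proof.
split=> [w a u v|v a u w]; first by rewrite tensDl tensZl.
by rewrite tensDr tensZr.
Qed.

Section Map.
Context {V V' W W' : lmodType K} (f : {linear V -> V'}) (g : {linear W -> W'}).

Definition tmap : tensor V W -> tensor V' W' :=
  tensor_lift (fun v w => tens (f v) (g w)).

Fact tmap_bilinear : bilinear_map (fun v w => tens (f v) (g w)).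
Proof. by split=> *; rewrite linearP (tensDl, tensDr) (tensZl, tensZr). Qed.
HB.instance Definition _ := GRing.isLinear.Build K (tensor V W) (tensor V' W') *:%R tmap
  (tensor_lift_linear tmap_bilinear).

Lemma tmapE v w : tmap (tens v w) = tens (f v) (g w).
Proof. exact: (tensor_liftE tmap_bilinear). Qed.
End Map.

Section Contract.
Context {V W : lmodType K}.

(* f (x) Id and Id (x) f for a linear form f, followed by K (x) W = W and V (x) K = V. *)
Definition contractl (f : {scalar V}) : tensor V W -> W :=
  tensor_lift (fun v w => f v *: w).
Definition contractr (f : {scalar W}) : tensor V W -> V :=
  tensor_lift (fun v w => f w *: v).

Fact contractl_bilinear (f : {scalar V}) : bilinear_map (fun v (w : W) => f v *: w).
Proof.
split=> [w a u v|v a u w]; first by rewrite linearP scalerDl scalerA.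
by rewrite scalerDr !scalerA mulrC.
Qed.
Fact contractr_bilinear (f : {scalar W}) : bilinear_map (fun (v : V) w => f w *: v).
Proof.
split=> [w a u v|v a u w]; last by rewrite linearP scalerDl scalerA.
by rewrite scalerDr !scalerA mulrC.
Qed.
HB.instance Definition _ f := GRing.isLinear.Build K (tensor V W) W *:%R (contractl f)
  (tensor_lift_linear (contractl_bilinear f)).
HB.instance Definition _ f := GRing.isLinear.Build K (tensor V W) V *:%R (contractr f)
  (tensor_lift_linear (contractr_bilinear f)).

Lemma contractlE f v w : contractl f (tens v w) = f v *: w.
Proof. exact: (tensor_liftE (contractl_bilinear f)). Qed.
Lemma contractrE f v w : contractr f (tens v w) = f w *: v.
Proof. exact: (tensor_liftE (contractr_bilinear f)). Qed.

Definition tflip : tensor V W -> tensor W V := tensor_lift (fun v w => tens w v).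
Fact tflip_bilinear : bilinear_map (fun (v : V) (w : W) => tens w v).
Proof. by split=> *; rewrite (tensDl, tensDr) (tensZl, tensZr). Qed.
HB.instance Definition _ := GRing.isLinear.Build K (tensor V W) (tensor W V) *:%R tflip
  (tensor_lift_linear tflip_bilinear).
Lemma tflipE v w : tflip (tens v w) = tens w v.
Proof. exact: (tensor_liftE tflip_bilinear). Qed.
End Contract.

Section Assoc.
Context {U V W : lmodType K}.

(* u (x) (v (x) w) |-> (u (x) v) (x) w *)
Definition tassoc : tensor U (tensor V W) -> tensor (tensor U V) W :=
  tensor_lift (fun u => tensor_lift (fun v w => tens (tens u v) w)).

Fact tassoc_bilinear1 (u : U) : bilinear_map (fun (v : V) (w : W) => tens (tens u v) w).
Proof.
split=> [w a v v'|v a w w']; last by rewrite tensDr tensZr.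
by rewrite tensDr tensZr tensDl tensZl.
Qed.
Fact tassoc_bilinear :
  bilinear_map (fun u : U => tensor_lift (fun (v : V) (w : W) => tens (tens u v) w)).
Proof.
split=> [x a u u'|u a x y]; last exact: (tensor_lift_linear (tassoc_bilinear1 u)).
move: x; apply: tensor_ind => [|x y hx hy|v w].
  have h0 (u1 : U) : tensor_lift (fun (v : V) (w : W) => tens (tens u1 v) w) 0 = 0.
    have := tensor_lift_linear (tassoc_bilinear1 u1) 1 0 0.
    by rewrite !scale1r addr0 -[LHS]addr0 => /addrI.
  by rewrite !h0 scaler0 addr0.
- have hD (u1 : U) : tensor_lift (fun (v : V) (w : W) => tens (tens u1 v) w) (x + y) =
     tensor_lift (fun (v : V) (w : W) => tens (tens u1 v) w) x +
     tensor_lift (fun (v : V) (w : W) => tens (tens u1 v) w) y.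
    by have := tensor_lift_linear (tassoc_bilinear1 u1) 1 x y; rewrite !scale1r.
  by rewrite !hD hx hy scalerDr addrACA.
- rewrite !(tensor_liftE (tassoc_bilinear1 _)).
  by rewrite tensDl tensZl tensDl tensZl.
Qed.
HB.instance Definition _ :=
  GRing.isLinear.Build K (tensor U (tensor V W)) (tensor (tensor U V) W) *:%R tassoc
  (tensor_lift_linear tassoc_bilinear).
Lemma tassocE u v w : tassoc (tens u (tens v w)) = tens (tens u v) w.
Proof.
by rewrite /tassoc (tensor_liftE tassoc_bilinear) (tensor_liftE (tassoc_bilinear1 _)).
Qed.
End Assoc.

End TensorMaps.

Section Decomposition.
Context {K : fieldType} {V : lmodType K}.

Definition span (P : set V) : set V :=
  [set v | forall S : set V, is_subspace S -> P `<=` S -> S v].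

Lemma span_subspace (P : set V) : is_subspace (span P).
Proof.
split=> [S hS _|a u v hu hv S hS hP]; first exact: hS.1.
by apply: hS.2; [exact: hu|exact: hv].
Qed.

Lemma sub_span (P : set V) : P `<=` span P.
Proof. by move=> v Pv S _; apply. Qed.

Lemma span_min (P S : set V) : is_subspace S -> P `<=` S -> span P `<=` S.
Proof. by move=> hS hP v; apply. Qed.

Context {I : choiceType}.
Variable U : I -> set V.

Definition decomposes (v : V) (f : I -> V) : Prop :=
  [/\ finsupp f, forall i, U i (f i) & v = \sum_(i \in [set: I]) f i].

Definition direct_decomp : Prop :=
  (forall i, is_subspace (U i)) /\ (forall v, exists! f, decomposes v f).

(* The component of [v] in [U i]. *)
Definition dcomp (i : I) (v : V) : V := xget (fun=> 0) [set f | decomposes v f] i.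

(* The operator acting on each [U i] as the scalar [a i]. *)
Definition dscale (a : I -> K) (v : V) : V := \sum_(i \in [set: I]) a i *: dcomp i v.

Hypothesis hU : direct_decomp.

Lemma dcompP v : decomposes v (dcomp^~ v).
Proof.
have [f [hf _]] := hU.2 v.
rewrite /dcomp; case: xgetP => [g -> hg|h]; last by have := h f.
by [].
Qed.

Lemma dcomp_uniq v f : decomposes v f -> forall i, dcomp i v = f i.
Proof.
move=> hf i; have [g [hg ug]] := hU.2 v.
have h1 := ug _ (dcompP v); have h2 := ug _ hf.
by move: h1; rewrite h2 => ->.
Qed.

Lemma dcomp_finsupp v : finsupp (dcomp^~ v). Proof. by case: (dcompP v). Qed.
Lemma dcomp_in v i : U i (dcomp i v). Proof. by case: (dcompP v). Qed.
Lemma dcomp_sum v : v = \sum_(i \in [set: I]) dcomp i v. Proof. by case: (dcompP v). Qed.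

Lemma dcomp_linear i : linear (dcomp i).
Proof.
move=> a u v; apply: (dcomp_uniq (f := fun i => a *: dcomp i u + dcomp i v)); split.
- apply: finsuppD; last exact: dcomp_finsupp.
  by apply: (finsupp_morph (F := fun=> *:%R a)); [move=> _; rewrite scaler0|exact: dcomp_finsupp].
- by move=> j; apply: (hU.1 j).2; exact: dcomp_in.
- by rewrite fsum_lin -?dcomp_sum//; exact: dcomp_finsupp.
Qed.

Lemma dcompE i j v : U i v -> dcomp j v = if j == i then v else 0.
Proof.
move=> hv; apply: (dcomp_uniq (f := fun j => if j == i then v else 0)); split.
- by exists [:: i] => k; rewrite inE => /negbTE ->.
- by move=> k; case: eqP => [->//|_]; exact: (hU.1 k).1.
- by rewrite (fsum_only (i := i)) ?eqxx// => k /negbTE ->.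
Qed.

Lemma dscale_finsupp a v : finsupp (fun i => a i *: dcomp i v).
Proof.
apply: (finsupp_morph (F := fun i => *:%R (a i))); last exact: dcomp_finsupp.
by move=> i; rewrite scaler0.
Qed.

Lemma dscale_linear a : linear (dscale a).
Proof.
move=> b u v; rewrite /dscale -fsum_lin; try exact: dscale_finsupp.
apply: eq_fsbigr => i _; rewrite dcomp_linear scalerDr !scalerA.
by rewrite [a i * b]mulrC.
Qed.

Definition dscale_lin (a : I -> K) : {linear V -> V} := HB.pack (dscale a)
  (GRing.isLinear.Build K V V *:%R (dscale a) (dscale_linear a)).

Lemma dscale_linE a v : dscale_lin a v = dscale a v. Proof. by []. Qed.

Lemma dscaleE a i v : U i v -> dscale a v = a i *: v.
Proof.
move=> hv; rewrite /dscale (fsum_only (i := i)) ?(dcompE _ hv) ?eqxx//.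
by move=> j /negbTE; rewrite (dcompE _ hv) => ->; rewrite scaler0.
Qed.

Lemma decomp_ind (P : V -> Prop) : P 0 -> (forall u v, P u -> P v -> P (u + v)) ->
  (forall i v, U i v -> P v) -> forall v, P v.
Proof.
move=> P0 PD PU v; rewrite (dcomp_sum v).
have [s hs] := dcomp_finsupp v; rewrite (fsum_seq hs).
elim/big_ind: _ => // i _; exact: (PU i) (dcomp_in _ _).
Qed.

End Decomposition.

Definition binom {K : fieldType} (a : K) (i : nat) : K :=
  (\prod_(j < i) (a - j%:R)) / (i`!)%:R.

(* [voc_Delta k] is the coefficient of [z^(-k-1)] in [Upsilon(z)]. *)
Record voc_data (K : fieldType) := VocData {
  voc_space :> lmodType K;
  voc_gr : int -> set voc_space;
  voc_Delta : int -> {linear voc_space -> tensor voc_space voc_space};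
  voc_c : {scalar voc_space};
  voc_rho : {scalar voc_space} }.
Arguments voc_gr {K}.
Arguments voc_Delta {K}.
Arguments voc_c {K}.
Arguments voc_rho {K}.

Section VocAxioms.
Context {K : fieldType} (V : voc_data K).
Local Notation Delta := (voc_Delta V).
Local Notation gr := (voc_gr V).

Definition tensor_gr (n : int) : set (tensor V V) :=
  span [set x | exists s u w, [/\ gr s u, gr (n - s) w & x = tens u w]].

(* The projection of V (x) V onto its component of degree [n]. *)
Definition tensor_comp (n : int) : tensor V V -> tensor V V :=
  tensor_lift (fun u w => \sum_(s \in [set: int]) tens (dcomp gr s u) (dcomp gr (n - s) w)).

(* (rho (x) Id) Upsilon(z) = \sum_k L(k) z^(k-2) *)
Definition voc_L (k : int) : {linear V -> V} := contractl (voc_rho V) \o Delta (1 - k).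

(* The coefficients of z_0^(-l-1) z_1^(-m-1) z_2^(-n-1) in the three terms of the Jacobi
   identity applied to [v], in (V (x) V) (x) V.  With (z_1 - z_2)^l expanded in powers of
   z_2, one has
     z_0^-1 delta((z_1 - z_2)/z_0)
       = \sum_(l, i >= 0) (-1)^i binom(l, i) z_0^(-l-1) z_1^(l-i) z_2^i,
   and similarly for the other two delta functions. *)
Definition jacobi1 (l m n : int) (v : V) : tensor (tensor V V) V :=
  \sum_(i \in [set: nat]) ((-1) ^+ i * binom (l%:~R : K) i) *:
    tassoc (tmap idfun (Delta (n + i%:Z)) (Delta (m + l - i%:Z) v)).
Definition jacobi2 (l m n : int) (v : V) : tensor (tensor V V) V :=
  \sum_(i \in [set: nat]) ((-1) ^ l * (-1) ^+ i * binom (l%:~R : K) i) *: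
    tmap tflip idfun (tassoc (tmap idfun (Delta (m + i%:Z)) (Delta (n + l - i%:Z) v))).
Definition jacobi3 (l m n : int) (v : V) : tensor (tensor V V) V :=
  \sum_(i \in [set: nat]) binom (m%:~R : K) i *:
    tmap (Delta (l + i%:Z)) idfun (Delta (m + n - i%:Z) v).

Record is_gvoc : Prop := IsGvoc {
  gr_direct : direct_decomp gr;
  gr_findim : forall s, exists (d : nat) (e : 'I_d -> V), gr s `<=` span (range e);
  gr_lower : exists N : int, forall s v, s < N -> gr s v -> v = 0;
  Delta_lower : forall v, exists N : int, forall k, k < N -> Delta k v = 0;
  Delta_gr : forall k s v, gr s v -> tensor_gr (s + k + 1) (Delta k v);
  left_counit : forall k v, contractl (voc_c V) (Delta k v) = if k == -1 then v else 0;
  right_counit : forall v, contractr (voc_c V) (Delta (-1) v) = v /\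
    forall k, -1 < k -> contractr (voc_c V) (Delta k v) = 0;
  jacobi : forall l m n v, jacobi1 l m n v - jacobi2 l m n v = jacobi3 l m n v;
  virasoro : exists d : K, forall (k j : int) v,
    voc_L k (voc_L j v) - voc_L j (voc_L k v) =
    (k - j)%:~R *: voc_L (k + j) v +
    (if k + j == 0 then ((k ^+ 3 - k)%:~R / 12%:R * d) *: v else 0);
  gr_eigen : forall s v, gr s v <-> voc_L 0 v = s%:~R *: v;
  (* the coefficient of z^(-k-1) in d/dz Upsilon(z) is - k Delta_(k-1) *)
  L1_derivative : forall k v,
    tmap (voc_L 1) idfun (Delta k v) = - (k%:~R *: Delta (k - 1) v) }.

End VocAxioms.

Record gvoc (K : fieldType) := Gvoc {
  gvoc_data :> voc_data K;
  gvocP : is_gvoc gvoc_data }.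

Section VocTheory.
Context {K : fieldType} (V : gvoc K).
Local Notation gr := (voc_gr V).
Local Notation Delta := (voc_Delta V).

Let hgr : direct_decomp gr := gr_direct (gvocP V).

HB.instance Definition _ s := GRing.isLinear.Build K V V *:%R (dcomp gr s)
  (dcomp_linear (gr_direct (gvocP V)) s).

Fact tensor_comp_bilinear n : bilinear_map
  (fun u w : V => \sum_(s \in [set: int]) tens (dcomp gr s u) (dcomp gr (n - s) w)).
Proof.
have fs u w : finsupp (fun s => tens (dcomp gr s u) (dcomp gr (n - s) w)).
  by have [s hs] := dcomp_finsupp hgr u; exists s => i hi; rewrite hs// tens0l.
split=> [w a u u'|u a w w']; rewrite -fsum_lin//; apply: eq_fsbigr => s _.
  by rewrite linearP tensDl tensZl.
by rewrite linearP tensDr tensZr.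
Qed.
HB.instance Definition _ n := GRing.isLinear.Build K (tensor V V) (tensor V V) *:%R
  (@tensor_comp K V n) (tensor_lift_linear (tensor_comp_bilinear n)).

Lemma tensor_compE n u w : @tensor_comp K V n (tens u w) =
  \sum_(s \in [set: int]) tens (dcomp gr s u) (dcomp gr (n - s) w).
Proof. exact: (tensor_liftE (tensor_comp_bilinear n)). Qed.

Lemma tensor_comp_gr n m (x : tensor V V) : tensor_gr m x ->
  tensor_comp n x = if n == m then x else 0.
Proof.
move=> /(_ [set x | tensor_comp n x = if n == m then x else 0]); apply.
  split=> /= [|a u v hu hv]; first by rewrite linear0 if_same.
  by rewrite linearP/= hu hv; case: eqP => // _; rewrite scaler0 addr0.
move=> _ [s [u [w [hu hw ->]]]] /=; rewrite tensor_compE.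
rewrite (fsum_only (i := s)) => [|t hts]; last first.
  by rewrite (dcompE hgr _ hu) (negbTE hts) tens0l.
rewrite (dcompE hgr _ hu) eqxx (dcompE hgr _ hw) subr_eq subrK.
by case: eqP => // _; rewrite tens0r.
Qed.

Lemma tensor_comp_finsupp n v : finsupp (fun k => tensor_comp n (Delta k v)).
Proof.
move: v; apply: (decomp_ind hgr) => [|u v hu hv|s v hv].
- by exists [::] => k _; rewrite !linear0.
- have [t ht] := finsuppD hu hv; exists t => k hk.
  by rewrite !linearD ht.
- exists [:: n - s - 1] => k; rewrite inE => hk.
  have hd : tensor_gr (s + k + 1) (Delta k v) by apply: Delta_gr hv; exact: gvocP.
  rewrite (tensor_comp_gr _ hd).
  case: eqP => // hn; move: hk; rewrite hn.
  by rewrite addrAC addrK addrAC subrr add0r eqxx.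
Qed.

(* The coefficient of z^j in (1 + z)^a. *)
Definition binser (a : K) (j : int) : K := if j is Posz i then binom a i else 0.

(* For an operator-valued series O(z) = \sum_j O_j z^j, the component of degree [n] of
   Res_z (O(z) (x) Id) Upsilon(z) v, the latter being an element of the product over [n]
   of the spaces (V (x) V)_n. *)
Definition residue (O : int -> {linear V -> V}) (v : V) (n : int) : tensor V V :=
  \sum_(j \in [set: int]) tensor_comp n (tmap (O j) idfun (Delta j v)).

Lemma tensor_comp_tmap (f : {linear V -> V}) n x : (forall s v, gr s v -> gr s (f v)) ->
  tensor_comp n (tmap f idfun x) = tmap f idfun (tensor_comp n x).
Proof.
move=> hf; pose F : {linear tensor V V -> tensor V V} := @tensor_comp K V n \o tmap f idfun.
pose G : {linear tensor V V -> tensor V V} := tmap f idfun \o @tensor_comp K V n.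
apply: (eq_tensor (f := F) (g := G)) => u w /=; rewrite tmapE !tensor_compE.
have fc s : dcomp gr s (f u) = f (dcomp gr s u).
  apply: (dcomp_uniq hgr (f := fun s => f (dcomp gr s u))); split.
  - by apply: (finsupp_morph (F := fun=> f)); [move=> _; exact: linear0|exact: dcomp_finsupp].
  - by move=> t; apply: hf; exact: dcomp_in.
  - by rewrite {1}(dcomp_sum hgr u) fsum_linear//; exact: dcomp_finsupp.
rewrite fsum_linear; last first.
  by have [t ht] := dcomp_finsupp hgr u; exists t => i hi; rewrite ht// tens0l.
by apply: eq_fsbigr => s _; rewrite /= tmapE fc.
Qed.

Lemma residue_finsupp (O : int -> {linear V -> V}) v n :
  (forall j s v, gr s v -> gr s (O j v)) ->
  finsupp (fun j => tensor_comp n (tmap (O j) idfun (Delta j v))).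
Proof.
move=> hO; have [t ht] := tensor_comp_finsupp n v; exists t => j hj.
by rewrite tensor_comp_tmap ?ht ?linear0//; exact: hO.
Qed.

Lemma residue_linear (O : int -> {linear V -> V}) n :
  (forall j s v, gr s v -> gr s (O j v)) -> linear (fun v => residue O v n).
Proof.
move=> hO a u v; rewrite /residue -fsum_lin; try exact: residue_finsupp.
by apply: eq_fsbigr => j _; rewrite !linearP.
Qed.

Lemma residue_ker_subspace (O : int -> {linear V -> V}) :
  (forall j s v, gr s v -> gr s (O j v)) ->
  is_subspace [set v | forall n, residue O v n = 0].
Proof.
move=> hO; split=> [n|a u v hu hv n]; last first.
  by rewrite residue_linear// hu hv scaler0 addr0.
have := residue_linear n hO 1 0 0.
by rewrite !scale1r addr0 -[LHS]addr0 => /addrI.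
Qed.

Lemma dscale_gr a s v : gr s v -> gr s (dscale gr a v).
Proof.
move=> hv; rewrite (dscaleE hgr _ hv) -[_ *: _]addr0.
by apply: (hgr.1 s).2 => //; exact: (hgr.1 s).1.
Qed.

(* The coefficients of z^j in (1+z)^L(0) / z^2 and (1+z)^L(0) / z. *)
Definition Cop (j : int) : {linear V -> V} :=
  dscale_lin (gr_direct (gvocP V)) (fun s => binser s%:~R (j + 2)).
Definition Dop (j : int) : {linear V -> V} :=
  dscale_lin (gr_direct (gvocP V)) (fun s => binser s%:~R (j + 1)).

Fact C_subspace : is_subspace [set v | forall n, residue Cop v n = 0].
Proof. by apply: residue_ker_subspace => j s v; exact: dscale_gr. Qed.

Definition Cspace : subspace V := Subspace _ C_subspace.

Definition Cdelta (v : V) (n : int) : tensor V V := residue Dop v n.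

End VocTheory.

Section DecompositionTheory.
Context {K : fieldType} {V : lmodType K}.

Lemma direct_decomp_proj {I : choiceType} (U : I -> set V) (p : I -> {linear V -> V}) :
  (forall i, is_subspace (U i)) ->
  (forall i j v, U i v -> p j v = if j == i then v else 0) ->
  (forall v, exists f, decomposes U v f) -> direct_decomp U.
Proof.
move=> hS hp hex; split=> // v.
have huniq f : decomposes U v f -> f = p^~ v.
  move=> [ff fU ->]; apply/funext => i; rewrite fsum_linear// (fsum_only (i := i)).
    by rewrite (hp i)// eqxx.
  by move=> j hj; rewrite (hp j)// eq_sym (negbTE hj).
have [f hf] := hex v; exists f; split=> // g hg.
by rewrite (huniq _ hf) (huniq _ hg).
Qed.

Lemma decomposes0 {I : choiceType} (U : I -> set V) :
  (forall i, is_subspace (U i)) -> decomposes U 0 (fun=> 0).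
Proof.
move=> hS; split; first by exists [::].
  by move=> i; exact: (hS i).1.
by rewrite fsbig1.
Qed.

Lemma decomposesD {I : choiceType} (U : I -> set V) u v f g :
  (forall i, is_subspace (U i)) -> decomposes U u f -> decomposes U v g ->
  decomposes U (u + v) (fun i => f i + g i).
Proof.
move=> hS [ff fU ->] [fg gU ->]; split; first exact: finsuppD.
  by move=> i; rewrite -[f i]scale1r; apply: (hS i).2.
by rewrite fsumD.
Qed.

Lemma decomposes1 {I : choiceType} (U : I -> set V) i v :
  (forall i, is_subspace (U i)) -> U i v ->
  decomposes U v (fun j => if j == i then v else 0).
Proof.
move=> hS hv; split.
- by exists [:: i] => k; rewrite inE => /negbTE ->.
- by move=> k; case: eqP => [->//|_]; exact: (hS k).1.
- by rewrite (fsum_only (i := i)) ?eqxx// => k /negbTE ->.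
Qed.

Lemma direct_decomp_joint {I J : choiceType} (U : I -> set V) (W : J -> set V) :
  direct_decomp U -> direct_decomp W ->
  (forall i j v, U i v -> U i (dcomp W j v)) ->
  direct_decomp (fun p : I * J => U p.1 `&` W p.2).
Proof.
move=> hU hW hUW.
have hS p : is_subspace (U p.1 `&` W p.2).
  split; first by split; [exact: (hU.1 _).1|exact: (hW.1 _).1].
  by move=> a u v [hu hu'] [hv hv']; split; [exact: (hU.1 _).2|exact: (hW.1 _).2].
pose pU i : {linear V -> V} := HB.pack (dcomp U i)
  (GRing.isLinear.Build K V V *:%R (dcomp U i) (dcomp_linear hU i)).
pose pW j : {linear V -> V} := HB.pack (dcomp W j)
  (GRing.isLinear.Build K V V *:%R (dcomp W j) (dcomp_linear hW j)).
apply: (@direct_decomp_proj (I * J)%type _ (fun p => pW p.2 \o pU p.1)) => //.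
  move=> [i j] [i' j'] v [/= hv hv']; rewrite (dcompE hU _ hv) xpair_eqE.
  case: eqP => _ /=; last exact: (linear0 (pW j')).
  exact: (dcompE hW _ hv').
pose P v := exists f, decomposes (fun p : I * J => U p.1 `&` W p.2) v f.
have P0 : P 0 by exists (fun=> 0); exact: decomposes0.
have PD u v : P u -> P v -> P (u + v).
  by move=> [f hf] [g hg]; exists (fun i => f i + g i); exact: decomposesD.
apply: (decomp_ind hU P0 PD) => i v hv.
rewrite (dcomp_sum hW v).
have [s hs] := dcomp_finsupp hW v; rewrite (fsum_seq hs).
elim/big_ind: _ => // j _; exists (fun p => if p == (i, j) then dcomp W j v else 0).
apply: (decomposes1 hS); split; first exact: hUW.
exact: dcomp_in.
Qed.

Section Eigen.
Variables (g : {linear V -> V}) (T : nat) (z : K).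
Hypotheses (T_gt0 : (0 < T)%N) (T_neq0 : T%:R != 0 :> K) (zT : z ^+ T = 1)
  (z_prim : forall m, (0 < m < T)%N -> z ^+ m != 1) (gT : forall v, iter T g v = v).

Let z0 : z != 0.
Proof. by apply/eqP => z0; move/eqP: zT; rewrite z0 expr0n gtn_eqF// eq_sym oner_eq0. Qed.

Let geom (b : K) : b ^+ T = 1 -> b != 1 -> \sum_(i < T) b ^+ i = 0.
Proof.
move=> hT h1; have := subrX1 b T; rewrite hT subrr => /esym/eqP.
by rewrite mulf_eq0 subr_eq0 (negbTE h1) => /eqP.
Qed.

Let W (r : 'I_T) : set V := [set v | g v = z ^+ r *: v].

Let iter_lin i a u v : iter i g (a *: u + v) = a *: iter i g u + iter i g v.
Proof. by elim: i => //= i IH; rewrite IH linearP. Qed.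

Let q (r : 'I_T) (v : V) : V :=
  (T%:R^-1 : K) *: \sum_(i < T) (z ^- r) ^+ i *: iter i g v.

Let q_linear r : linear (q r).
Proof.
move=> a u v; rewrite /q scalerA mulrC -scalerA -scalerDr; congr (_ *: _).
rewrite scaler_sumr -big_split/=; apply: eq_bigr => i _.
by rewrite iter_lin scalerDr !scalerA mulrC.
Qed.

Let zrT (r : nat) : (z ^- r) ^+ T = 1.
Proof. by rewrite exprVn -exprM mulnC exprM zT expr1n invr1. Qed.

Let qW r v : W r (q r v).
Proof.
rewrite /W/= /q linearZ/= scalerA [_ * T%:R^-1]mulrC -scalerA; congr (_ *: _).
rewrite linear_sum scaler_sumr/=.
pose F i := z ^+ r *: ((z ^- r) ^+ i *: iter i g v).
rewrite (eq_bigr (fun i : 'I_T => F i.+1)); last first.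
  move=> i _; rewrite /F linearZ/= exprS !scalerA mulrA divff ?mul1r//.
  exact: expf_neq0.
rewrite -[RHS]/(\sum_(i < T) F i); apply: (@addrI _ (F 0)).
rewrite -(big_ord_recl T (fun i : 'I_T.+1 => F i)) big_ord_recr/= addrC.
by rewrite /F zrT gT expr0.
Qed.

Let W_subspace r : is_subspace (W r).
Proof.
split=> [|a u v hu hv]; rewrite /W/=; first by rewrite linear0 scaler0.
by rewrite linearP hu hv scalerDr !scalerA mulrC.
Qed.

Let qE r s v : W r v -> q s v = if s == r then v else 0.
Proof.
move=> hv; rewrite /q.
have hi i : iter i g v = (z ^+ r) ^+ i *: v.
  elim: i => [|i IH]; first by rewrite scale1r.
  by rewrite iterS IH linearZ/= hv scalerA exprSr.
rewrite (eq_bigr (fun i : 'I_T => (z ^- s * z ^+ r) ^+ i *: v)); last first.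
  by move=> i _; rewrite hi scalerA exprMn.
rewrite -scaler_suml scalerA; case: eqP => [->|hsr].
  rewrite mulVf ?expf_neq0// (eq_bigr (fun=> 1)) => [|i _]; last by rewrite expr1n.
  by rewrite sumr_const card_ord mulVf// scale1r.
rewrite geom ?mulr0 ?scale0r//.
  by rewrite exprMn zrT mul1r -exprM mulnC exprM zT expr1n.
rewrite mulrC; have hs := expf_neq0 s z0; have hr := expf_neq0 r z0.
case: (ltngtP s r) => [h|h|/val_inj//].
  have := @z_prim (r - s)%N; rewrite subn_gt0 h (leq_ltn_trans (leq_subr _ _) (ltn_ord r)).
  by move=> /(_ isT); rewrite expfB.
have := @z_prim (s - r)%N; rewrite subn_gt0 h (leq_ltn_trans (leq_subr _ _) (ltn_ord s)).
by move=> /(_ isT); rewrite expfB// -invr_eq1 invf_div.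
Qed.

Lemma eigen_decomp : direct_decomp W.
Proof.
pose p r : {linear V -> V} := HB.pack (q r)
  (GRing.isLinear.Build K V V *:%R (q r) (q_linear r)).
apply: (@direct_decomp_proj _ W p) => // v.
exists (q^~ v); split=> //; first by exists (enum 'I_T) => i; rewrite mem_enum.
rewrite (fsum_seq (s := enum 'I_T)) => [|i]; last by rewrite mem_enum.
rewrite undup_id ?enum_uniq// big_enum/= /q -scaler_sumr exchange_big/=.
rewrite (eq_bigr (fun i : 'I_T => (\sum_(r < T) (z ^- i) ^+ r) *: iter i g v)); last first.
  move=> i _; rewrite scaler_suml; apply: eq_bigr => r _; congr (_ *: _).
  by rewrite !exprVn -!exprM mulnC.
rewrite (bigD1 (Ordinal T_gt0))//= [X in _ *: (_ + X)]big1 => [|i hi]; last first.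
  rewrite geom ?scale0r ?zrT// invr_eq1; apply: z_prim; rewrite ltn_ord andbT.
  by rewrite lt0n; apply: contraNneq hi => hi; apply/eqP/val_inj.
rewrite addr0 (eq_bigr (fun=> 1)) => [|i _]; last by rewrite expr0 invr1 expr1n.
by rewrite sumr_const card_ord scalerA mulVf// scale1r.
Qed.

End Eigen.
End DecompositionTheory.

Section RootsOfUnity.
Context {R : realType}.

(* e^(ix) *)
Definition cis (x : R) : R[i] := Complex (cos x) (sin x).

Lemma cisD x y : cis (x + y) = cis x * cis y.
Proof.
rewrite /cis cosD sinD; apply/eqP; rewrite eq_complex /= eqxx/=.
by rewrite [X in X == _]addrC.
Qed.

Lemma cis0 : cis 0 = 1. Proof. by rewrite /cis cos0 sin0. Qed.

Lemma cisMn x n : cis (x *+ n) = cis x ^+ n.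
Proof. by elim: n => [|n IH]; rewrite ?mulr0n ?cis0// mulrS exprS cisD IH. Qed.

Lemma cis_neq1 x : 0 < x < 2 * pi -> cis x != 1.
Proof.
move=> /andP[x0 x2]; apply/negP => /eqP [] hc _.
have hx : x = (x / 2) *+ 2 by rewrite -mulr_natr divfK ?pnatr_eq0.
have /lt0r_neq0 : 0 < sin (x / 2).
  by apply: sin_gt0_pi; rewrite divr_gt0//= ltr_pdivrMr// mulrC.
move: hc; rewrite {1}hx cos_mulr2n cos2sin2 => /eqP.
rewrite subr_eq -mulr2n eqr_pMn2r// subr_eq addrC -subr_eq subrr eq_sym sqrf_eq0.
by move=> /eqP ->; rewrite eqxx.
Qed.

Lemma cis_2pi : cis (2 * pi) = 1.
Proof. by rewrite mulrC mulr_natr /cis cos2pi sin2pi. Qed.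

Section PrimitiveRoot.
Variable T : nat.
Hypothesis T_gt0 : (0 < T)%N.

Lemma cis_root (r : nat) : cis (2 * pi * r%:R / T%:R) = cis (2 * pi / T%:R) ^+ r.
Proof. by rewrite -cisMn -[X in _ = cis X]mulr_natr mulrAC. Qed.

Lemma cis_rootT : cis (2 * pi / T%:R) ^+ T = 1.
Proof. by rewrite -cis_root mulfK ?cis_2pi// pnatr_eq0 -lt0n. Qed.

Lemma cis_root_prim m : (0 < m < T)%N -> cis (2 * pi / T%:R) ^+ m != 1.
Proof.
move=> /andP[m0 mT]; rewrite -cis_root; apply: cis_neq1.
have pp : 0 < 2 * pi :> R by rewrite mulr_gt0// pi_gt0.
apply/andP; split; last by rewrite ltr_pdivrMr ?ltr0n// ltr_pM2l// ltr_nat.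
by apply: divr_gt0; [apply: mulr_gt0|]; rewrite ?ltr0n.
Qed.
End PrimitiveRoot.

End RootsOfUnity.

Record voc_aut (K : fieldType) (V : gvoc K) := VocAut {
  aut_map :> {linear V -> V};
  aut_bij : bijective aut_map;
  aut_c : forall v, voc_c V (aut_map v) = voc_c V v;
  aut_rho : forall v, voc_rho V (aut_map v) = voc_rho V v;
  aut_Delta : forall k v,
    voc_Delta V k (aut_map v) = tmap aut_map aut_map (voc_Delta V k v) }.

Definition has_order {K : fieldType} {V : gvoc K} (g : voc_aut V) (T : nat) : Prop :=
  [/\ (0 < T)%N, forall v, iter T g v = v &
      forall m, (0 < m < T)%N -> exists v, iter m g v <> v].

Record aut_of_order (K : fieldType) (V : gvoc K) (T : nat) := AutOfOrder {
  aut_of :> voc_aut V;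
  aut_order : has_order aut_of T }.

Section Twisted.
Context {R : realType} {V : gvoc R[i]} {T : nat}.
Variable g : aut_of_order V T.
Local Notation gr := (voc_gr V).
Local Notation Delta := (voc_Delta V).

(* V^(r) *)
Definition eigsp (r : 'I_T) : set V :=
  [set v | g v = cis (2 * pi * r%:R / T%:R) *: v].

Lemma aut_T_gt0 : (0 < T)%N. Proof. by have [] := aut_order g. Qed.

Lemma eigsp_decomp : direct_decomp eigsp.
Proof.
have [T0 gT _] := aut_order g.
have -> : eigsp = fun r : 'I_T => [set v | g v = cis (2 * pi / T%:R) ^+ r *: v].
  by apply/funext => r; rewrite /eigsp cis_root.
apply: eigen_decomp => //.
- by rewrite pnatr_eq0 -lt0n.
- exact: cis_rootT.
- exact: cis_root_prim.
Qed.

Lemma contractl_aut (x : tensor V V) :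
  contractl (voc_rho V) (tmap g g x) = g (contractl (voc_rho V) x).
Proof.
pose F : {linear tensor V V -> V} := contractl (voc_rho V) \o tmap g g.
pose G : {linear tensor V V -> V} := g \o contractl (voc_rho V).
apply: (eq_tensor (f := F) (g := G)) => u w /=.
by rewrite tmapE !contractlE aut_rho linearZ.
Qed.

Lemma aut_gr s v : gr s v -> gr s (g v).
Proof.
have hV := gvocP V.
rewrite !(gr_eigen hV) /voc_L/= => h.
by rewrite aut_Delta contractl_aut h linearZ.
Qed.

Lemma gr_eigsp s r v : gr s v -> gr s (dcomp eigsp r v).
Proof.
have hV := gvocP V; have hgr := gr_direct hV => hv.
have h : dcomp gr s (dcomp eigsp r v) = dcomp eigsp r v; last by rewrite -h; exact: dcomp_in.
apply/esym.
apply: (dcomp_uniq eigsp_decomp (f := fun r => dcomp gr s (dcomp eigsp r v))); split.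
- apply: (finsupp_morph (F := fun=> dcomp gr s)); first by move=> _; exact: linear0.
  exact: (dcomp_finsupp eigsp_decomp).
- move=> q; have := dcomp_in eigsp_decomp v q; rewrite /eigsp/= => hq.
  rewrite -linearZ/= -hq; apply/esym.
  apply: (dcomp_uniq hgr (f := fun s => g (dcomp gr s (dcomp eigsp q v)))); split.
  + apply: (finsupp_morph (F := fun=> g)); first by move=> _; exact: linear0.
    exact: dcomp_finsupp.
  + by move=> t; apply: aut_gr; exact: dcomp_in.
  + by rewrite -fsum_linear; [rewrite -(dcomp_sum hgr)|exact: dcomp_finsupp].
- rewrite -fsum_linear; last exact: (dcomp_finsupp eigsp_decomp).
  by rewrite -(dcomp_sum eigsp_decomp)/= (dcompE hgr _ hv) eqxx.
Qed.

(* V_s and V^(r) *)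
Definition gr_eig (p : int * 'I_T) : set V := gr p.1 `&` eigsp p.2.

Lemma gr_eig_decomp : direct_decomp gr_eig.
Proof.
apply: direct_decomp_joint; [exact: (gr_direct (gvocP V))|exact: eigsp_decomp|].
by move=> s r v; exact: gr_eigsp.
Qed.

Lemma dscale_gr_eig a s v : gr s v -> gr s (dscale gr_eig a v).
Proof.
move=> hv; have [S0 SD] := (gr_direct (gvocP V)).1 s.
rewrite [in dscale _ _ v](dcomp_sum eigsp_decomp v).
rewrite -(dscale_linE gr_eig_decomp) fsum_linear; last exact: (dcomp_finsupp eigsp_decomp).
apply: subspace_fsum => // r; rewrite dscale_linE.
rewrite (dscaleE gr_eig_decomp _ (i := (s, r))).
  by rewrite -[_ *: _]addr0; apply: SD => //; exact: gr_eigsp.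
by split; [exact: gr_eigsp|exact: (dcomp_in eigsp_decomp)].
Qed.

(* [fix0 r] is 1 if [r = 0] and 0 otherwise, and [delta0] is the projection onto V^(0). *)
Definition fix0 (r : 'I_T) : nat := (r == 0%N :> nat).
Definition delta0 : {linear V -> V} := dscale_lin eigsp_decomp (fun r => (fix0 r)%:R).

(* The coefficients of z^j in (1+z)^(L(0) - 1 + delta0 + (ln g)/(2 pi i)) / z^(1 + delta0)
   and in delta0 (1+z)^L(0) / z. *)
Definition Cgop (j : int) : {linear V -> V} := dscale_lin gr_eig_decomp (fun p =>
  binser (p.1%:~R - 1 + (fix0 p.2)%:R + p.2%:R / T%:R) (j + 1 + (fix0 p.2)%:Z)).
Definition Dgop (j : int) : {linear V -> V} := delta0 \o Dop V j.

Lemma Cgop_fix j s (r : 'I_T) v : r = 0%N :> nat -> gr_eig (s, r) v ->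
  Cgop j v = binser s%:~R (j + 2) *: v.
Proof.
move=> r0 hv; rewrite /Cgop dscale_linE (dscaleE gr_eig_decomp _ hv)/= /fix0 r0 eqxx.
by rewrite mul0r addr0 subrK -addrA.
Qed.

Lemma Cgop_nonfix j s (r : 'I_T) v : r != 0%N :> nat -> gr_eig (s, r) v ->
  Cgop j v = binser (s%:~R - 1 + r%:R / T%:R) (j + 1) *: v.
Proof.
move=> r0 hv; rewrite /Cgop dscale_linE (dscaleE gr_eig_decomp _ hv)/= /fix0 (negbTE r0).
by rewrite !addr0.
Qed.

Fact Cg_subspace : is_subspace [set v | forall n, residue Cgop v n = 0].
Proof. by apply: residue_ker_subspace => j s v; exact: dscale_gr_eig. Qed.

Definition Cgspace : subspace V := Subspace _ Cg_subspace.

Definition Cgdelta (v : V) (n : int) : tensor V V := residue Dgop v n.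

End Twisted.

Lemma span_map {K : fieldType} {V W : lmodType K} (F : {linear V -> W}) (P : set V) (Q : set W)
  (v : V) : (forall u, P u -> span Q (F u)) -> span P v -> span Q (F v).
Proof.
move=> h; apply: (@span_min _ _ _ [set v | span Q (F v)]) => //.
have [S0 SD] := span_subspace Q.
split=> [|a x y hx hy] /=; first by rewrite linear0.
by rewrite linearP; exact: SD.
Qed.

Section TensorNaturality.
Context {K : fieldType}.

Lemma tmap_comp (U V W U' V' W' : lmodType K) (f : {linear U -> V}) (f' : {linear V -> W})
  (h : {linear U' -> V'}) (h' : {linear V' -> W'}) x :
  tmap f' h' (tmap f h x) = tmap (f' \o f) (h' \o h) x.
Proof.
pose F : {linear tensor U U' -> tensor W W'} := tmap f' h' \o tmap f h.
pose G : {linear tensor U U' -> tensor W W'} := tmap (f' \o f) (h' \o h).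
by apply: (eq_tensor (f := F) (g := G)) => u w; rewrite /F /G/= !tmapE.
Qed.

Lemma eq_tmap (V W V' W' : lmodType K) (f f' : {linear V -> W}) (h h' : {linear V' -> W'}) :
  f =1 f' -> h =1 h' -> tmap f h =1 tmap f' h'.
Proof. by move=> ff hh; apply: eq_tensor => u w /=; rewrite !tmapE ff hh. Qed.

Lemma tmap_flip (V W V' W' : lmodType K) (f : {linear V -> W}) (h : {linear V' -> W'}) x :
  tflip (tmap f h x) = tmap h f (tflip x).
Proof.
pose F : {linear tensor V V' -> tensor W' W} := tflip \o tmap f h.
pose G : {linear tensor V V' -> tensor W' W} := tmap h f \o tflip.
apply: (eq_tensor (f := F) (g := G)) => u w; rewrite /F /G/=.
by rewrite tmapE !tflipE tmapE.
Qed.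

Lemma tmap_assoc (U V W U' V' W' : lmodType K) (f : {linear U -> U'})
  (h : {linear V -> V'}) (k : {linear W -> W'}) x :
  tassoc (tmap f (tmap h k) x) = tmap (tmap f h) k (tassoc x).
Proof.
pose F : {linear tensor U (tensor V W) -> tensor (tensor U' V') W'} :=
  tassoc \o tmap f (tmap h k).
pose G : {linear tensor U (tensor V W) -> tensor (tensor U' V') W'} :=
  tmap (tmap f h) k \o tassoc.
apply: (eq_tensor (f := F) (g := G)) => u; apply: tensor_ind.
- by rewrite tens0r !linear0.
- by move=> y z hy hz; rewrite tensDr !linearD hy hz.
- by move=> v w; rewrite /F /G/= tassocE !tmapE/= !tmapE tassocE.
Qed.

Lemma contractl_tmap (V W V' W' : lmodType K) (f : {linear V -> V'}) (h : {linear W -> W'})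
  (c : {scalar V}) (c' : {scalar V'}) x : (forall v, c' (f v) = c v) ->
  contractl c' (tmap f h x) = h (contractl c x).
Proof.
move=> hc; pose F : {linear tensor V W -> W'} := contractl c' \o tmap f h.
pose G : {linear tensor V W -> W'} := h \o contractl c.
apply: (eq_tensor (f := F) (g := G)) => u w; rewrite /F /G/=.
by rewrite tmapE !contractlE linearZ hc.
Qed.

Lemma contractr_tmap (V W V' W' : lmodType K) (f : {linear V -> V'}) (h : {linear W -> W'})
  (c : {scalar W}) (c' : {scalar W'}) x : (forall v, c' (h v) = c v) ->
  contractr c' (tmap f h x) = f (contractr c x).
Proof.
move=> hc; pose F : {linear tensor V W -> V'} := contractr c' \o tmap f h.
pose G : {linear tensor V W -> V'} := f \o contractr c.
apply: (eq_tensor (f := F) (g := G)) => u w; rewrite /F /G/=.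
by rewrite tmapE !contractrE linearZ hc.
Qed.

End TensorNaturality.

Section FixedQuotient.
Context {R : realType} {V : gvoc R[i]} {T : nat}.
Variable g : aut_of_order V T.
Local Notation gr := (voc_gr V).
Local Notation Delta := (voc_Delta V).

(* The sum of the V^(r) for r <> 0. *)
Definition nonfix : subspace V :=
  Subspace _ (span_subspace (\bigcup_(r in [set r : 'I_T | r != 0%N :> nat]) eigsp g r)).

Local Notation Vg := (quot_space nonfix).
Definition fixpi : {linear V -> Vg} := quot_proj nonfix.

Let hV := gvocP V.
Let hgr := gr_direct hV.
Let hE := eigsp_decomp g.

Lemma cis_eig_neq1 (r : 'I_T) : r != 0%N :> nat -> cis (2 * pi * r%:R / T%:R) != 1 :> R[i].
Proof.
by move=> r0; rewrite cis_root; apply: (cis_root_prim (aut_T_gt0 g)); rewrite lt0n r0 ltn_ord.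
Qed.

Lemma vanish_nonfix (W : lmodType R[i]) (F : {linear V -> W}) :
  (forall v, F (g v) = F v) -> forall v, nonfix v -> F v = 0.
Proof.
move=> hF v; apply: (@span_min _ _ _ [set v | F v = 0]) => {v}.
  split=> [|a x y hx hy] /=; first exact: linear0.
  by rewrite linearP hx hy scaler0 addr0.
move=> v [r /= r0 hv]; have := hF v; rewrite hv linearZ => /eqP.
rewrite -[X in _ == X]scale1r -subr_eq0 -scalerBl scaler_eq0 subr_eq0.
by rewrite (negbTE (cis_eig_neq1 r0)) => /eqP.
Qed.

Lemma fixpi_aut v : fixpi (g v) = fixpi v.
Proof.
apply/eqP; rewrite -subr_eq0 -linearB; apply/eqP/quot_projP.
have [S0 SD] := span_subspace (\bigcup_(r in [set r : 'I_T | r != 0%N :> nat]) eigsp g r).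
move: v; apply: (decomp_ind hE); first by rewrite linear0 subr0.
  move=> u v hu hv; rewrite linearD opprD addrACA -[_ u - u]scale1r.
  exact: SD.
move=> r v hv; have [r0|r0] := eqVneq (r : nat) 0%N.
  by move: hv; rewrite /eigsp/= r0 mulr0 mul0r cis0 scale1r => ->; rewrite subrr.
rewrite hv -[X in _ - X]scale1r -scalerBl -[_ *: _]addr0; apply: SD => //.
by apply: sub_span; exists r.
Qed.

Fact fix_c_van v : nonfix v -> voc_c V v = 0.
Proof. by apply: (vanish_nonfix (F := voc_c V : {linear V -> R[i]^o})) => u; exact: aut_c. Qed.
Fact fix_rho_van v : nonfix v -> voc_rho V v = 0.
Proof. by apply: (vanish_nonfix (F := voc_rho V : {linear V -> R[i]^o})) => u; exact: aut_rho. Qed.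

Definition Delta_pi (k : int) : {linear V -> tensor Vg Vg} := tmap fixpi fixpi \o Delta k.

Fact Delta_pi_van k v : nonfix v -> Delta_pi k v = 0.
Proof.
apply: vanish_nonfix => u; rewrite /Delta_pi/= aut_Delta tmap_comp.
by apply: eq_tmap => x /=; exact: fixpi_aut.
Qed.

Definition fix_gr (s : int) : set Vg := fixpi @` gr s.

Definition fix_Delta (k : int) : {linear Vg -> tensor Vg Vg} :=
  HB.pack (quot_lift (S := nonfix) (Delta_pi k))
    (GRing.isLinear.Build R[i] Vg (tensor Vg Vg) *:%R (quot_lift (S := nonfix) (Delta_pi k))
       (quot_lift_linear (@Delta_pi_van k))).
Definition fix_c : {scalar Vg} :=
  HB.pack (quot_lift (S := nonfix) (voc_c V))
    (GRing.isLinear.Build R[i] Vg R[i] *%R (quot_lift (S := nonfix) (voc_c V))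
       (quot_lift_linear (F := voc_c V : {linear V -> R[i]^o}) fix_c_van)).
Definition fix_rho : {scalar Vg} :=
  HB.pack (quot_lift (S := nonfix) (voc_rho V))
    (GRing.isLinear.Build R[i] Vg R[i] *%R (quot_lift (S := nonfix) (voc_rho V))
       (quot_lift_linear (F := voc_rho V : {linear V -> R[i]^o}) fix_rho_van)).

Lemma fix_DeltaE k v : fix_Delta k (fixpi v) = tmap fixpi fixpi (Delta k v).
Proof. exact: (quot_liftE _ (@Delta_pi_van k)). Qed.
Lemma fix_cE v : fix_c (fixpi v) = voc_c V v.
Proof. exact: (quot_liftE (F := voc_c V : {linear V -> R[i]^o}) v fix_c_van). Qed.
Lemma fix_rhoE v : fix_rho (fixpi v) = voc_rho V v.
Proof. exact: (quot_liftE (F := voc_rho V : {linear V -> R[i]^o}) v fix_rho_van). Qed.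

Definition fix_data : voc_data R[i] := @VocData R[i] Vg fix_gr fix_Delta fix_c fix_rho.

Lemma fix_data_DeltaE k v :
  voc_Delta fix_data k (fixpi v) = tmap fixpi fixpi (Delta k v).
Proof. exact: fix_DeltaE. Qed.

Let fixP (P : Vg -> Prop) : (forall v, P (fixpi v)) -> forall x, P x.
Proof. exact: quot_ind. Qed.

Let gr_nonfix s v : nonfix v -> nonfix (dcomp gr s v).
Proof.
apply: span_map => u [r r0 hu]; apply: sub_span; exists r => //.
have hg : g (dcomp gr s u) = dcomp gr s (g u).
  apply/esym; apply: (dcomp_uniq hgr (f := fun s => g (dcomp gr s u))); split.
  - apply: (finsupp_morph (F := fun=> g)); first by move=> _; exact: linear0.
    exact: dcomp_finsupp.
  - by move=> t; apply: aut_gr; exact: dcomp_in.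
  - by rewrite -fsum_linear; [rewrite -(dcomp_sum hgr)|exact: dcomp_finsupp].
by rewrite /eigsp/= hg hu linearZ.
Qed.

Definition comp_pi (s : int) : {linear V -> Vg} := fixpi \o dcomp gr s.

Let comp_pi_van s v : nonfix v -> comp_pi s v = 0.
Proof. by move=> hv; exact: (quot_projP nonfix _).2 (gr_nonfix s hv). Qed.

Let fix_gr_direct : direct_decomp fix_gr.
Proof.
pose p s : {linear Vg -> Vg} :=
  HB.pack (quot_lift (S := nonfix) (comp_pi s))
    (GRing.isLinear.Build R[i] Vg Vg *:%R (quot_lift (S := nonfix) (comp_pi s))
       (quot_lift_linear (@comp_pi_van s))).
have pE s v : p s (fixpi v) = fixpi (dcomp gr s v).
  exact: (quot_liftE _ (@comp_pi_van s)).
apply: (@direct_decomp_proj _ _ _ _ p).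
- move=> s; split; first by exists 0; [exact: (hgr.1 s).1|exact: linear0].
  move=> a _ _ [u hu <-] [v hv <-]; exists (a *: u + v); last by rewrite linearP.
  exact: (hgr.1 s).2.
- by move=> s t _ [v hv <-]; rewrite pE (dcompE hgr _ hv); case: eqP; rewrite ?linear0.
apply: fixP => v; exists (fun s => fixpi (dcomp gr s v)); split.
- apply: (finsupp_morph (F := fun=> fixpi)); last exact: dcomp_finsupp.
  by move=> _; exact: linear0.
- by move=> s; exists (dcomp gr s v) => //; exact: dcomp_in.
- by rewrite -fsum_linear; [rewrite -(dcomp_sum hgr)|exact: dcomp_finsupp].
Qed.

Let fix_L k v : voc_L fix_data k (fixpi v) = fixpi (voc_L V k v).
Proof.
rewrite -[LHS]/(contractl fix_rho (fix_Delta (1 - k) (fixpi v))) fix_DeltaE.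
by rewrite (contractl_tmap _ _ (c := voc_rho V))// => u; exact: fix_rhoE.
Qed.

Let PPi : {linear tensor (tensor V V) V -> tensor (tensor Vg Vg) Vg} :=
  tmap (tmap fixpi fixpi) fixpi.

Let jac_finsupp (W : lmodType R[i]) (c : nat -> R[i]) (n : int) (v : V)
  (F : nat -> {linear tensor V V -> W}) :
  finsupp (fun i => c i *: F i (Delta (n - i%:Z) v)).
Proof.
have [N hN] := Delta_lower hV v.
exists (iota 0 `|n - N|.+1) => i; rewrite mem_iota/= add0n -leqNgt => hi.
rewrite hN ?linear0 ?scaler0// ltrBlDl -ltrBlDr.
apply: le_lt_trans (ler_norm _) _.
by rewrite -abszE ltz_nat.
Qed.

Let fix_jacobi1 l m n v : jacobi1 (V := fix_data) l m n (fixpi v) = PPi (jacobi1 (V := V) l m n v).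
Proof.
rewrite /jacobi1 fsum_linear; last first.
  exact: (jac_finsupp _ _ _ (fun i => tassoc \o tmap idfun (Delta (n + i%:Z)))).
apply: eq_fsbigr => i _; rewrite linearZ [in LHS]fix_data_DeltaE; congr (_ *: _).
rewrite [RHS]/= tmap_comp -tmap_assoc tmap_comp; congr tassoc.
by apply: eq_tmap => x //; exact: fix_data_DeltaE.
Qed.

Let fix_jacobi2 l m n v : jacobi2 (V := fix_data) l m n (fixpi v) = PPi (jacobi2 (V := V) l m n v).
Proof.
rewrite /jacobi2 fsum_linear; last first.
  exact: (jac_finsupp _ _ _
    (fun i => tmap tflip idfun \o (tassoc \o tmap idfun (Delta (m + i%:Z))))).
apply: eq_fsbigr => i _; rewrite linearZ [in LHS]fix_data_DeltaE; congr (_ *: _).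
rewrite [RHS]/=.
set y := Delta (n + l - _) v.
transitivity (tmap tflip idfun
    (tmap (tmap fixpi fixpi) fixpi (tassoc (tmap idfun (Delta (m + i%:Z)) y)))).
  rewrite -tmap_assoc; congr (tmap _ _ (tassoc _)); rewrite !tmap_comp.
  by apply: eq_tmap => x //; exact: fix_data_DeltaE.
by rewrite !tmap_comp; apply: eq_tmap => x //=; rewrite tmap_flip.
Qed.

Let fix_jacobi3 l m n v : jacobi3 (V := fix_data) l m n (fixpi v) = PPi (jacobi3 (V := V) l m n v).
Proof.
rewrite /jacobi3 fsum_linear; last first.
  exact: (jac_finsupp _ _ _ (fun i => tmap (Delta (l + i%:Z)) idfun)).
apply: eq_fsbigr => i _; rewrite linearZ [in LHS]fix_data_DeltaE; congr (_ *: _).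
rewrite [RHS]/= !tmap_comp.
by apply: eq_tmap => x //; exact: fix_data_DeltaE.
Qed.

Lemma fix_is_gvoc : is_gvoc fix_data.
Proof.
split.
- exact: fix_gr_direct.
- move=> s; have [d [e he]] := gr_findim hV s; exists d, (fixpi \o e) => _ [v hv <-].
  apply: span_map (he _ hv) => _ [i _ <-]; apply: sub_span; by exists i.
- have [N hN] := gr_lower hV; exists N => s _ hs [v hv <-].
  by rewrite (hN _ _ hs hv) linear0.
- apply: fixP => v; have [N hN] := Delta_lower hV v; exists N => k hk.
  by rewrite fix_DeltaE hN// linear0.
- move=> k s _ [v hv <-]; rewrite fix_DeltaE.
  apply: span_map (Delta_gr hV hv) => _ [t [u [w [hu hw ->]]]].
  apply: sub_span; exists t, (fixpi u), (fixpi w).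
  by split; [exists u|exists w|exact: tmapE].
- move=> k; apply: fixP => v; rewrite fix_DeltaE.
  rewrite (contractl_tmap _ _ (c := voc_c V)) ?(left_counit hV)//; last exact: fix_cE.
  by case: eqP; rewrite ?linear0.
- apply: fixP => v; have [h1 h2] := right_counit hV v; split=> [|k hk]; rewrite fix_DeltaE.
    by rewrite (contractr_tmap _ _ (c := voc_c V)) ?h1//; exact: fix_cE.
  by rewrite (contractr_tmap _ _ (c := voc_c V)) ?h2 ?linear0//; exact: fix_cE.
- move=> l m n; apply: fixP => v.
  by rewrite fix_jacobi1 fix_jacobi2 fix_jacobi3 -linearB (jacobi hV).
- have [d hd] := virasoro hV; exists d => k j; apply: fixP => v.
  rewrite !fix_L -linearB hd linearD linearZ; congr (_ + _).
  by case: eqP; rewrite ?linear0 ?linearZ.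
- move=> s; apply: fixP => v; split.
    by move=> [u /(gr_eigen hV) hu <-]; rewrite fix_L hu linearZ.
  rewrite fix_L -linearZ => h; exists (dcomp gr s v); first exact: dcomp_in.
  have L0E t : dcomp gr t (voc_L V 0 v) = t%:~R *: dcomp gr t v.
    apply: (dcomp_uniq hgr (f := fun t => t%:~R *: dcomp gr t v)); split.
    - exact: (dscale_finsupp hgr (fun t => t%:~R)).
    - move=> i; rewrite -[_ *: _]addr0; apply: (hgr.1 i).2; [exact: dcomp_in|exact: (hgr.1 i).1].
    - rewrite {1}(dcomp_sum hgr v) fsum_linear; last exact: dcomp_finsupp.
      apply: eq_fsbigr => i _; apply/(gr_eigen hV); exact: dcomp_in.
  have hs : nonfix (voc_L V 0 v - s%:~R *: v).
    by apply/quot_projP; rewrite linearB; apply/eqP; rewrite subr_eq0; apply/eqP.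
  rewrite [in RHS](dcomp_sum hgr v) fsum_linear; last exact: dcomp_finsupp.
  rewrite (fsum_only (i := s))// => t hts; apply/eqP.
  have e : dcomp gr t (voc_L V 0 v - s%:~R *: v) = (t%:~R - s%:~R) *: dcomp gr t v.
    by rewrite linearB [X in _ - X]linearZ/= L0E scalerBl.
  have := comp_pi_van t hs; rewrite -[LHS]/(fixpi (dcomp gr t (voc_L V 0 v - s%:~R *: v))).
  rewrite e [LHS]linearZ => /eqP.
  by rewrite scaler_eq0 subr_eq0 eqr_int (negbTE hts).
- move=> k; apply: fixP => v; rewrite !fix_DeltaE tmap_comp.
  transitivity (tmap fixpi fixpi (tmap (voc_L V 1) idfun (Delta k v))).
    by rewrite tmap_comp; apply: eq_tmap => x //=; exact: fix_L.
  by rewrite (L1_derivative hV) linearN linearZ.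
Qed.

Definition fix_quotient : gvoc R[i] := Gvoc fix_is_gvoc.

Definition canproj : {linear V -> fix_quotient} := fixpi.

End FixedQuotient.

(** Coalgebras whose coproduct is a priori only a relation: [coalg_cop x t] says that
    [t] is the coproduct of [x].  This is used for subspaces of a vertex operator
    coalgebra on which the coproduct has values in a completion. *)

Record coalg_data (K : fieldType) := CoalgData {
  coalg_space :> lmodType K;
  coalg_cop : coalg_space -> tensor coalg_space coalg_space -> Prop;
  coalg_counit : {scalar coalg_space} }.

Section Coalgebras.
Context {K : fieldType}.
Implicit Types C D : coalg_data K.

Definition coassoc_coalg C : Prop :=
  exists Delta : {linear C -> tensor C C},
  [/\ forall x, coalg_cop x (Delta x),
      forall x, tassoc (tmap idfun Delta (Delta x)) = tmap Delta idfun (Delta x),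
      forall x, contractl (coalg_counit C) (Delta x) = x &
      forall x, contractr (coalg_counit C) (Delta x) = x].

Definition coalg_hom C D (f : {linear C -> D}) : Prop :=
  (forall x t, coalg_cop x t -> coalg_cop (f x) (tmap f f t)) /\
  (forall x, coalg_counit D (f x) = coalg_counit C x).

(* The coproduct maps S into S (x) S. *)
Definition subcoalgebra C (S : subspace C) : Prop :=
  forall x : sublmod S, exists t : tensor (sublmod S) (sublmod S),
    coalg_cop (subincl S x) (tmap (subincl S) (subincl S) t).

Fact limage_subspace (V W : lmodType K) (f : {linear V -> W}) : is_subspace (range f).
Proof.
split=> [|a _ _ [u _ <-] [v _ <-]]; first by exists 0 => //; rewrite linear0.
by exists (a *: u + v) => //; rewrite linearP.
Qed.
Definition limage (V W : lmodType K) (f : {linear V -> W}) : subspace W :=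
  Subspace _ (limage_subspace f).

(* [S] with a coproduct [D] with values in the product of the (V (x) V)_n, and with the
   counit c. *)
Definition sub_coalg_data (V : gvoc K) (S : subspace V) (D : V -> int -> tensor V V) :
    coalg_data K :=
  @CoalgData K (sublmod S)
    (fun x t => forall n,
       tensor_comp n (tmap (subincl S) (subincl S) t) = D (subincl S x) n)
    (voc_c V \o subincl S).

Definition C_coalg (V : gvoc K) : coalg_data K := sub_coalg_data (Cspace V) (@Cdelta K V).

End Coalgebras.

Definition Cg_coalg {R : realType} {V : gvoc R[i]} {T : nat} (g : aut_of_order V T) :
  coalg_data R[i] := sub_coalg_data (Cgspace g) (Cgdelta g).

(* Main.v *)
From HB Require Import structures.
Require Import Defs.
From mathcomp Require Import all_boot all_order all_algebra.
From mathcomp Require Import complex.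
From mathcomp Require Import all_classical all_reals.

(** Let pi : V -> V^g be the projection.  It preserves degrees, commutes with the
    coproducts [voc_Delta], and kills V^(r) for r <> 0.  On V^(0) the operators
    that define C_g(V) and Delta_g are those that define C(V^g) and its
    coproduct, so pi intertwines them on all of V ([Cop_canproj],
    [Dop_canproj]).  Residues are natural with respect to such maps
    ([residue_graded]); hence pi maps C_g(V) to C(V^g) and carries Delta_g to the
    coproduct of C(V^g).

    Injectivity of pi on C_g(V) amounts to C_g(V) being contained in V^(0).  This
    is dual to the fact that V^(r), for r <> 0, is contained in the subspace O_g(V)
    by which Zhu's twisted algebra is the quotient, which one sees by inserting
    the vacuum as the second argument.  Here the vacuum becomes the counit: apply
    Id (x) c to the residue that defines C_g(V).  The series (Id (x) c) Upsilon(z) v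
    lies in v + z V[[z]], and on V^(r) the operator is (1+z)^(s-1+r/T) / z, whose
    only polar term is z^(-1) with coefficient 1.  So the V^(r)-component of the
    residue is that of v ([Cgspace_eigcomp]).

    Residues are given degree by degree, and Id (x) c is compatible with this
    because c vanishes outside V_0: indeed c o L(0) = (rho (x) c) Delta_1, which is
    0 since (Id (x) c) Upsilon(z) v has no polar term ([counit_L0], [contractr_comp]).

    Finally, suppose that Delta_g takes values in C_g(V) (x) C_g(V).  As pi
    intertwines the coproducts, the coproduct of pi(v) is the image of Delta_g(v)
    under pi (x) pi, so the image of pi is a subcoalgebra of C(V^g). *)

Set Implicit Arguments.
Unset Strict Implicit.
Unset Printing Implicit Defensive.
Import GRing.Theory Num.Theory Order.TTheory.
Local Open Scope classical_set_scope.
Local Open Scope ring_scope.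

(** * Corestriction to a subspace *)

Section Corestriction.
Context {K : fieldType} {V W : lmodType K} (S : subspace W) (f : {linear V -> W}).
Hypothesis fS : forall v, S (f v).

Definition corestr (v : V) : sublmod S := subelt (fS v).

Fact corestr_linear : linear corestr.
Proof. by move=> a u v; apply: (@subincl_inj _ _ S); rewrite [RHS]linearP; exact: linearP. Qed.
HB.instance Definition _ := GRing.isLinear.Build K V (sublmod S) *:%R corestr corestr_linear.

End Corestriction.

(** * Naturality of residues *)

Section GradedMaps.
Context {K : fieldType} {V W : gvoc K} (f : {linear V -> W}).
Hypothesis f_gr : forall s v, voc_gr V s v -> voc_gr W s (f v).

Let hV := gr_direct (gvocP V).
Let hW := gr_direct (gvocP W).

Lemma dcomp_graded s v : dcomp (voc_gr W) s (f v) = f (dcomp (voc_gr V) s v).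
Proof.
apply: (dcomp_uniq hW (f := fun s => f (dcomp (voc_gr V) s v))); split.
- by apply: (finsupp_morph (F := fun=> f)); [move=> _; exact: linear0|exact: dcomp_finsupp].
- by move=> t; apply: f_gr; exact: dcomp_in.
- by rewrite {1}(dcomp_sum hV v) fsum_linear//; exact: dcomp_finsupp.
Qed.

Lemma tensor_comp_graded n x :
  tensor_comp n (tmap f f x) = tmap f f (tensor_comp n x).
Proof.
pose F : {linear tensor V V -> tensor W W} := @tensor_comp K W n \o tmap f f.
pose G : {linear tensor V V -> tensor W W} := tmap f f \o @tensor_comp K V n.
apply: (eq_tensor (f := F) (g := G)) => u w /=; rewrite tmapE !tensor_compE.
rewrite fsum_linear; last first.
  by have [t ht] := dcomp_finsupp hV u; exists t => i hi; rewrite ht// tens0l.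
by apply: eq_fsbigr => s _; rewrite /= tmapE !dcomp_graded.
Qed.

Hypothesis f_Delta : forall k v,
  voc_Delta W k (f v) = tmap f f (voc_Delta V k v).

(** Each coefficient of the residue is transported by naturality of the tensor
    product; [O_gr] makes the sum over powers of z finite in every degree, so that
    [tmap f f] may be moved inside it. *)
Lemma residue_graded (O : int -> {linear V -> V}) (O' : int -> {linear W -> W}) v n :
  (forall j s u, voc_gr V s u -> voc_gr V s (O j u)) ->
  (forall j u, O' j (f u) = f (O j u)) ->
  residue O' (f v) n = tmap f f (residue O v n).
Proof.
move=> O_gr fO; rewrite /residue fsum_linear; last exact: residue_finsupp.
apply: eq_fsbigr => j _; rewrite f_Delta /= -tensor_comp_graded !tmap_comp.
by congr tensor_comp; apply: eq_tmap => u //=; exact: fO.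
Qed.

End GradedMaps.

(** * The counit lives in degree 0 *)

Section Counit.
Context {K : numFieldType} (V : gvoc K).
Local Notation gr := (voc_gr V).

(** Since L(0) = (rho (x) Id) Delta_1, one has c o L(0) = rho o (Id (x) c) Delta_1,
    and (Id (x) c) Delta_1 is a polar coefficient of (Id (x) c) Upsilon(z). *)
Lemma counit_L0 v : voc_c V (voc_L V 0 v) = 0.
Proof.
(* the form rho (x) c may be contracted in either order *)
have fub (x : tensor V V) :
    voc_c V (contractl (voc_rho V) x) = voc_rho V (contractr (voc_c V) x).
  pose F : {linear tensor V V -> K^o} := (voc_c V : {linear V -> K^o}) \o contractl (voc_rho V).
  pose G : {linear tensor V V -> K^o} := (voc_rho V : {linear V -> K^o}) \o contractr (voc_c V).
  apply: (eq_tensor (f := F) (g := G)) => u w.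
  by rewrite /F /G /= contractlE contractrE !linearZ; exact: mulrC.
by rewrite /voc_L /= fub subr0 (right_counit (gvocP V) v).2// linear0.
Qed.

Lemma counit_gr s v : s != 0 -> gr s v -> voc_c V v = 0.
Proof.
move=> s0 /(gr_eigen (gvocP V)) hv; have := counit_L0 v; rewrite hv linearZ => /eqP.
by rewrite /= mulf_eq0 intr_eq0 (negbTE s0) => /eqP.
Qed.

(** By [counit_gr], Id (x) c kills every V_s (x) V_(n-s) except V_n (x) V_0, which it
    maps to V_n; so it preserves degrees. *)
Lemma contractr_comp n (x : tensor V V) :
  contractr (voc_c V) (tensor_comp n x) = dcomp gr n (contractr (voc_c V) x).
Proof.
have hgr := gr_direct (gvocP V).
pose F : {linear tensor V V -> V} := contractr (voc_c V) \o @tensor_comp K V n.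
pose G : {linear tensor V V -> V} := dcomp gr n \o contractr (voc_c V).
apply: (eq_tensor (f := F) (g := G)) => u w; rewrite /F /G /= tensor_compE contractrE linearZ.
rewrite fsum_linear; last first.
  by have [t ht] := dcomp_finsupp hgr u; exists t => i hi; rewrite ht// tens0l.
rewrite (fsum_only (i := n)) => [|s sn]; rewrite /= contractrE; last first.
  by rewrite (counit_gr _ (dcomp_in hgr w _)) ?scale0r// subr_eq0 eq_sym.
congr (_ *: _); rewrite subrr {2}(dcomp_sum hgr w).
rewrite (fsum_linear (voc_c V : {linear V -> K^o})); last exact: dcomp_finsupp.
by rewrite (fsum_only (i := 0))// => s s0; exact: counit_gr (dcomp_in hgr w _).
Qed.

End Counit.

(** * The projection onto the fixed points quotient *)

Section Twisted.
Context {R : realType} {V : gvoc R[i]} {T : nat} (g : aut_of_order V T).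
Local Notation gr := (voc_gr V).
Local Notation Vg := (fix_quotient g).

Lemma canproj_gr s v : gr s v -> voc_gr Vg s (canproj g v).
Proof. by move=> hv; exists v. Qed.

Lemma canproj_Delta k v :
  voc_Delta Vg k (canproj g v) = tmap (canproj g) (canproj g) (voc_Delta V k v).
Proof. exact: fix_data_DeltaE. Qed.

Lemma canproj_eig0 (r : 'I_T) v : r != 0%N :> nat -> eigsp g r v -> canproj g v = 0.
Proof. by move=> r0 hv; apply/quot_projP => S _; apply; exists r. Qed.

(** On V^(0) both sides act by the coefficients of (1+z)^s / z^2; on V^(r) with
    r <> 0 the operators differ, but both sides are 0. *)
Lemma Cop_canproj j v : Cop Vg j (canproj g v) = canproj g (Cgop g j v).
Proof.
move: v; apply: (decomp_ind (gr_eig_decomp g)) => [|u v hu hv|[s r] v hv].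
- by rewrite !linear0.
- by rewrite !linearD hu hv.
have [r0|r0] := eqVneq (r : nat) 0%N.
  rewrite (Cgop_fix j r0 hv) linearZ dscale_linE.
  by rewrite (dscaleE (gr_direct (gvocP Vg)) _ (canproj_gr hv.1)).
by rewrite (Cgop_nonfix j r0 hv) linearZ (canproj_eig0 r0 hv.2) [LHS]linear0 [RHS]scaler0.
Qed.

Lemma Dgop_eig j s (r : 'I_T) v : gr_eig g (s, r) v ->
  Dgop g j v = (fix0 r)%:R *: (binser s%:~R (j + 1) *: v).
Proof.
move=> [/= hs hr].
transitivity (delta0 g (dscale gr (fun s => binser s%:~R (j + 1)) v)); first by [].
rewrite (dscaleE (gr_direct (gvocP V)) _ hs) linearZ /=.
by rewrite (dscaleE (eigsp_decomp g) _ hr) !scalerA mulrC.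
Qed.

Lemma Dop_canproj j v : Dop Vg j (canproj g v) = canproj g (Dgop g j v).
Proof.
move: v; apply: (decomp_ind (gr_eig_decomp g)) => [|u v hu hv|[s r] v hv].
- by rewrite !linear0.
- by rewrite !linearD hu hv.
rewrite (Dgop_eig j hv) linearZ dscale_linE.
rewrite (dscaleE (gr_direct (gvocP Vg)) _ (canproj_gr hv.1)) linearZ /fix0.
have [r0|r0] := eqVneq (r : nat) 0%N; first by rewrite mulr1n [RHS]scale1r.
by rewrite (canproj_eig0 r0 hv.2) mulr0n [LHS]scaler0 [RHS]scale0r.
Qed.

Lemma Dgop_gr j s v : gr s v -> gr s (Dgop g j v).
Proof.
have hgr := gr_direct (gvocP V).
move=> hv; have hDv := dscale_gr (fun s => binser s%:~R (j + 1)) hv.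
change (gr s (dscale (eigsp g) (fun r => (fix0 r)%:R)
  (dscale gr (fun s => binser s%:~R (j + 1)) v))).
apply: subspace_fsum; [exact: (hgr.1 s).1|exact: (hgr.1 s).2|move=> r].
rewrite -[_ *: _]addr0; apply: (hgr.1 s).2; last exact: (hgr.1 s).1.
exact: gr_eigsp.
Qed.

Lemma Cspace_canproj v : Cgspace g v -> Cspace Vg (canproj g v).
Proof.
move=> hv; change (forall n, residue (Cop Vg) (canproj g v) n = 0) => n.
rewrite (residue_graded canproj_gr canproj_Delta (O := Cgop g)).
- by rewrite (hv n) linear0.
- by move=> j s u; exact: dscale_gr_eig.
- exact: Cop_canproj.
Qed.

Lemma Cdelta_canproj v n :
  Cdelta (canproj g v) n = tmap (canproj g) (canproj g) (Cgdelta g v n).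
Proof.
apply: (residue_graded canproj_gr canproj_Delta).
- by move=> j s u; exact: Dgop_gr.
- exact: Dop_canproj.
Qed.

(** * C_g(V) is fixed by g *)

(** The projection [dcomp] packed with its linearity, which holds only for direct
    decompositions. *)
Definition eigcomp (r : 'I_T) : {linear V -> V} := HB.pack (dcomp (eigsp g) r)
  (GRing.isLinear.Build R[i] V V *:%R (dcomp (eigsp g) r) (dcomp_linear (eigsp_decomp g) r)).

Lemma eigcompE (r q : 'I_T) v : eigsp g q v -> eigcomp r v = if r == q then v else 0.
Proof. exact: dcompE (eigsp_decomp g) _ _ _. Qed.

(** On V^(r) the operator is (1+z)^a / z, and (1+z)^a is a power series with constant
    term 1; so z^(-1) is the only polar term. *)
Lemma eigcomp_Cgop (r : 'I_T) j v : r != 0%N :> nat -> j <= -1 ->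
  eigcomp r (Cgop g j v) = if j == -1 then eigcomp r v else 0.
Proof.
move=> r0 j1; move: v; apply: (decomp_ind (gr_eig_decomp g)) => [|u v hu hv|[s q] v hv].
- by rewrite !linear0 if_same.
- by rewrite !linearD hu hv; case: ifP; rewrite ?addr0.
have [q0|q0] := eqVneq (q : nat) 0%N.
  have qr : r == q = false by apply: contraNF r0 => /eqP ->; rewrite q0.
  by rewrite (Cgop_fix j q0 hv) linearZ /= (eigcompE r hv.2) qr scaler0 if_same.
rewrite (Cgop_nonfix j q0 hv) linearZ /=; case: eqP => [->|/eqP jn1].
  by rewrite addNr /= /binom big_ord0 fact0 divr1 scale1r.
have : j + 1 < 0 by rewrite -ltrBrDr sub0r lt_neqAle jn1.
by case: (j + 1) => // n _; rewrite scale0r.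
Qed.

(** In degree [n], the V^(r)-component of (Id (x) c) applied to the residue is that
    of the degree [n] part of v: the polar terms of (Id (x) c) Upsilon(z) v vanish, and
    so do the powers z^j, j < -1, of the operator, which leaves j = -1. *)
Lemma Cgspace_eigcomp (r : 'I_T) v : r != 0%N :> nat -> Cgspace g v -> eigcomp r v = 0.
Proof.
move=> r0 hv; have hgr := gr_direct (gvocP V).
have Cgop_gr j s u : gr s u -> gr s (Cgop g j u) by exact: dscale_gr_eig.
have hn n : eigcomp r (dcomp gr n v) = 0.
  pose F : {linear tensor V V -> V} := eigcomp r \o contractr (voc_c V).
  have termE j : F (tensor_comp n (tmap (Cgop g j) idfun (voc_Delta V j v))) =
      eigcomp r (Cgop g j (dcomp gr n (contractr (voc_c V) (voc_Delta V j v)))).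
    rewrite /F /= contractr_comp (contractr_tmap _ _ (c := voc_c V))//.
    by rewrite (dcomp_graded (Cgop_gr j)).
  have := congr1 F (hv n); rewrite linear0 /residue fsum_linear; last exact: residue_finsupp.
  have [counit0 counit_gt0] := right_counit (gvocP V) v.
  rewrite (fsum_only (i := -1)) => [|j jn1]; rewrite termE.
    by rewrite eigcomp_Cgop// counit0.
  have [j1|j1] := leP j (-1); first by rewrite eigcomp_Cgop// (negbTE jn1).
  by rewrite counit_gt0// !linear0.
rewrite (dcomp_sum hgr v) fsum_linear; last exact: dcomp_finsupp.
by rewrite fsbig1.
Qed.

(** The kernel of pi is the sum of the V^(r) with r <> 0, which has no V^(0)-component,
    while [Cgspace_eigcomp] excludes all others. *)
Lemma canproj_Cg_eq0 v : Cgspace g v -> canproj g v = 0 -> v = 0.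
Proof.
move=> hv /quot_projP hn; have hE := eigsp_decomp g.
rewrite (dcomp_sum hE v) fsbig1// => r _.
have [r0|r0] := eqVneq (r : nat) 0%N; last exact: Cgspace_eigcomp.
apply: (@span_min _ _ _ [set v | eigcomp r v = 0] _ _ v hn) => [|u [q q0 hu]] /=.
  split=> [|a x y hx hy]; first exact: (linear0 (eigcomp r)).
  change (eigcomp r (a *: x + y) = 0).
  by rewrite linearP [eigcomp r x]hx [eigcomp r y]hy scaler0 addr0.
rewrite (eigcompE r hu); case: eqP => // rq.
by move: q0; rewrite /= -rq r0.
Qed.

End Twisted.

(** * The induced map of coalgebras *)

Theorem proposition4p7 (R : realType) (V : gvoc R[i]) (T : nat) (g : aut_of_order V T) :
  exists pi_ind : {linear sublmod (Cgspace g) -> sublmod (Cspace (fix_quotient g))},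
  [/\ forall v, subincl _ (pi_ind v) = canproj g (subincl _ v),
      forall v n, tmap (canproj g) (canproj g) (Cgdelta g (subincl _ v) n) =
                  Cdelta (subincl _ (pi_ind v)) n,
      forall v, voc_c V (subincl _ v) = voc_c (fix_quotient g) (subincl _ (pi_ind v)),
      injective pi_ind &
      coassoc_coalg (Cg_coalg g) ->
        @coalg_hom _ (Cg_coalg g) (C_coalg (fix_quotient g)) pi_ind /\
        @subcoalgebra _ (C_coalg (fix_quotient g)) (limage pi_ind)].
Proof.
have piC (v : sublmod (Cgspace g)) : Cspace (fix_quotient g) ((canproj g \o subincl _) v).
  exact/Cspace_canproj/subinclP.
pose p : {linear sublmod (Cgspace g) -> sublmod (Cspace (fix_quotient g))} := corestr piC.
have pE v : subincl _ (p v) = canproj g (subincl _ v) by [].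
have p_cop x t : coalg_cop (c := Cg_coalg g) x t ->
    coalg_cop (c := C_coalg (fix_quotient g)) (p x) (tmap p p t).
  move=> xt n; transitivity (Cdelta (canproj g (subincl _ x)) n); last by [].
  have {}xt : tensor_comp n (tmap (subincl _) (subincl _) t) = Cgdelta g (subincl _ x) n.
    exact: xt.
  rewrite Cdelta_canproj -xt -(tensor_comp_graded (@canproj_gr _ _ _ g)).
  by rewrite !tmap_comp; congr tensor_comp; exact: eq_tmap.
have p_c v : voc_c (fix_quotient g) (subincl _ (p v)) = voc_c V (subincl _ v).
  by rewrite pE; exact: fix_cE.
exists p; split=> //.
- by move=> v n; rewrite pE Cdelta_canproj.
- move=> u v /(congr1 (subincl _)); rewrite !pE => /eqP; rewrite -subr_eq0 -!linearB => /eqP uv.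
  apply: (@subincl_inj _ _ (Cgspace g)); apply/eqP; rewrite -subr_eq0 -linearB; apply/eqP.
  exact: canproj_Cg_eq0 (subinclP _) uv.
move=> [D [D_cop _ _ _]]; split=> // x; have [y _ yx] := subinclP x.
have p_im v : limage p (p v) by exists v.
(* the coproduct of x = pi y is the image under pi (x) pi of that of y *)
exists (tmap (corestr p_im) (corestr p_im) (D y)).
rewrite -yx tmap_comp; have := p_cop _ _ (D_cop y).
by congr coalg_cop; exact: eq_tmap.
Qed.
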